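(* Let $T\geq 0$, let $v:[0,1]\to\mathbb{R}$ be a bounded Lipschitz function, and let $f:[0,1]\to\mathbb{R}$ be a piecewise bounded Lipschitz function such that $v(x)\neq 0$ at any point $x$ of discontinuity of $f$. Let $\nu_0\in\mathcal{M}([0,1])$ and let $\mu:[0,T]\to\mathcal{M}([0,1])$ be the (unique) mild solution on $[0,T]$, with initial value $\nu_0$, of $$\frac{\partial}{\partial t}\mu_t+\frac{\partial}{\partial x}(v\,\mu_t)=f\cdot\mu_t .$$ Then $\mu$ is a weak solution of this equation corresponding to the initial condition $\nu_0$; that is, $$\langle\mu_T,\psi(\cdot,T)\rangle-\langle\nu_0,\psi(\cdot,0)\rangle=\int_0^T\big\langle\mu_t,\ \partial_t\psi(\cdot,t)+\partial_x\psi(\cdot,t)\cdot v\big\rangle\,dt+\int_0^T\big\langle f\cdot\mu_t,\ \psi(\cdot,t)\big\rangle\,dt$$ for all $$\psi\in\Lambda^T:=\Big\{\psi\in C^1([0,1]\times[0,T])\ :\ \partial_x\psi(0,t)=\partial_x\psi(1,t)=0\ \text{ for all } 0\leq t\leq T\Big\}.$$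
   Context: **Measures and norms.** $\mathcal{M}([0,1])$ is the space of finite (signed) Borel measures on $[0,1]$. For $\mu\in\mathcal{M}([0,1])$ and a bounded measurable $\phi:[0,1]\to\mathbb{R}$, $\langle\mu,\phi\rangle:=\int_{[0,1]}\phi\,d\mu$. The measure $f\cdot\mu$ is the one with density $f$ with respect to $\mu$. $\|\cdot\|_{\mathrm{TV}}$ is the total variation norm, $\|\mu\|_{\mathrm{TV}}=\sup\{\langle\mu,\phi\rangle:\phi\in C_b([0,1]),\ \|\phi\|_\infty\leq1\}$. $\mathrm{BL}([0,1])$ is the space of real-valued bounded Lipschitz functions on $[0,1]$ with norm $\|\phi\|_{\mathrm{BL}}:=\|\phi\|_\infty+|\phi|_{\mathrm{L}}$, where $|\phi|_{\mathrm{L}}$ is the (smallest) Lipschitz constant of $\phi$. The dual bounded Lipschitz norm on $\mathcal{M}([0,1])$ is $\|\mu\|^*_{\mathrm{BL}}:=\sup\{|\langle\mu,\phi\rangle|:\phi\in\mathrm{BL}([0,1]),\ \|\phi\|_{\mathrm{BL}}\leq1\}$. $\mathcal{M}([0,1])_{\mathrm{BL}}$ denotes $\mathcal{M}([0,1])$ with this norm, and its completion is its closure in $\mathrm{BL}([0,1])^*$ (via $\mu\mapsto\langle\mu,\cdot\rangle$). **Piecewise bounded Lipschitz.** $f:[0,1]\to\mathbb{R}$ is piecewise bounded Lipschitz if there are finitely many points $0=a_0<a_1<\dots<a_m=1$ such that the restriction of $f$ to each open interval $(a_{i-1},a_i)$ is bounded and Lipschitz (so $f$ is bounded with finitely many discontinuities).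 **Stopped flow.** For $x_0\in[0,1]$ let $x(\cdot\,;x_0)$ be the unique solution in $[0,1]$ of $\dot x(t)=v(x(t))$, $x(0)=x_0$, with maximal interval of existence $I_{x_0}\subset[0,\infty)$ (i.e. as long as the solution remains in $[0,1]$), and let $\tau_\partial(x_0):=\sup I_{x_0}\in[0,\infty]$. In particular $\tau_\partial(x_0)=0$ if $x_0$ is a boundary point where $v$ points outwards. The stopped flow is, for $t\geq0$, $$\Phi_t(x_0):=\begin{cases}x(t;x_0),&t\in I_{x_0},\\ x(\tau_\partial(x_0);x_0),&\text{otherwise.}\end{cases}$$ Define $P_t:\mathcal{M}([0,1])\to\mathcal{M}([0,1])$ by push-forward: $P_t\mu:=\Phi_t\#\mu=\mu\circ\Phi_t^{-1}$. **Mild solution.** A (measure-valued) mild solution on $[0,T]$ with initial value $\nu_0\in\mathcal{M}([0,1])$ is a continuous map $\mu:[0,T]\to\mathcal{M}([0,1])_{\mathrm{BL}}$ that is $\|\cdot\|_{\mathrm{TV}}$-bounded and satisfies the variation of constants formula $$\mu_t=P_t\nu_0+\int_0^tP_{t-s}\big(f\cdot\mu_s\big)\,ds\qquad\text{for all }t\in[0,T],$$ where the integral is that of a measure-valued map with respect to $\|\cdot\|^*_{\mathrm{BL}}$ (Bochner integral in the completion of $\mathcal{M}([0,1])_{\mathrm{BL}}$). Under the stated hypotheses on $v$, $f$, such a mild solution is known to exist and to be unique for each $T\geq0$ and each $\nu_0\in\mathcal{M}([0,1])$. *)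

(* Defs.v *)
From HB Require Import structures.
From mathcomp Require Import all_boot all_order all_algebra.
From mathcomp Require Import all_classical all_reals all_analysis measurable_realfun.

Set Implicit Arguments.
Unset Strict Implicit.
Unset Printing Implicit Defensive.

Import Order.TTheory GRing.Theory Num.Theory.
Import numFieldNormedType.Exports.

Local Open Scope classical_set_scope.
Local Open Scope ring_scope.

(** Conventions.
    - A function on [0,1], on [0,T] or on their product is represented by a
      function of arguments in [R], of which only the values on the domain are
      used.
    - An element of M([0,1]) is a charge (finite signed Borel measure) on [R]
      concentrated on [0,1].
    - A functional on BL([0,1]) is represented by a map [(R -> R) -> R], of
      which only the values on bounded Lipschitz functions are used. *)

Section Measures.
Context {R : realType}.
Implicit Types (m : set R -> \bar R) (phi f : R -> R).

Definition I01 : set R := `[0, 1]%classic.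

Definition concentrated m : Prop :=
  forall A, measurable A -> A `&` I01 = set0 -> m A = 0%E.

(** Upper and lower variation of a signed measure: the two parts of its Jordan
    decomposition, so that [pairing] is the integral with respect to the Jordan
    decomposition (see [pairingE]). They are defined for set functions, so that no measurability proof is needed to form
    [pairing m phi] when [m] is a push-forward or a measure with density. *)
Definition pos_variation m : set R -> \bar R :=
  fun A => ereal_sup [set m B | B in [set B | measurable B /\ B `<=` A]].

Definition neg_variation m : set R -> \bar R :=
  pos_variation (fun A => - m A)%E.

Definition pairing m phi : R :=
  fine (\int[pos_variation m]_(x in I01) (phi x)%:E)
  - fine (\int[neg_variation m]_(x in I01) (phi x)%:E).

(** [(f . m)(A) = \int_A f dm]. *)
Definition density f m : set R -> \bar R :=
  fun A => (pairing m (f \* \1_A))%:E.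

Definition TV_norm m : \bar R :=
  ereal_sup [set (pairing m phi)%:E | phi in
    [set phi | {within I01, continuous phi} /\
               (forall x, I01 x -> `|phi x| <= 1)]].

End Measures.

Section PairingCharge.
Context {R : realType}.
Variables (nu : {charge set R -> \bar R}) (P N : set R).
Hypothesis nuPN : hahn_decomposition nu P N.
Local Open Scope ereal_scope.

Lemma pos_variationE (A : set R) : measurable A ->
  pos_variation nu A = jordan_pos nuPN A.
Proof.
move=> mA; have [[mP posP] [mN negN] PNT PN0] := nuPN.
rewrite jordan_posE cjordan_posE /crestr0 mem_set// /crestr.
have mAP : measurable (A `&` P) by exact: measurableI.
apply/eqP; rewrite eq_le; apply/andP; split; last first.
  by apply: ereal_sup_ubound; exists (A `&` P) => //; split.
apply: ge_ereal_sup => _ [B [mB BA] <-].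
have mBP : measurable (B `&` P) by exact: measurableI.
have mD : measurable ((A `&` P) `\` (B `&` P)) by exact: measurableD.
rewrite (charge_partition _ _ mP mN)//.
rewrite (_ : A `&` P = (B `&` P) `|` ((A `&` P) `\` (B `&` P))); last first.
  by rewrite setDUK//; exact: setSI.
rewrite [leRHS]chargeU//; last by rewrite -subset0 => x [? []].
apply: leeD => //; apply: (@le_trans _ _ 0).
  by apply: negN => //; exact: measurableI.
by apply: posP => // x [[]].
Qed.

End PairingCharge.

Lemma neg_variationE (R : realType) (nu : {charge set R -> \bar R})
    (P N : set R) (nuPN : hahn_decomposition nu P N) (A : set R) :
  measurable A -> neg_variation nu A = jordan_neg nuPN A.
Proof.
move=> mA; have [[mP posP] [mN negN] PNT PN0] := nuPN.
have nuNP : hahn_decomposition (copp nu) N P.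
  split; [split => // B mB BN | split => // B mB BP | by rewrite setUC
         | by rewrite setIC]; rewrite /copp /=.
  - by rewrite leeNr oppe0; exact: negN.
  - by rewrite leeNl oppe0; exact: posP.
rewrite -[LHS]/(pos_variation (copp nu) A) (pos_variationE nuNP mA).
by rewrite jordan_posE jordan_negE cjordan_posE cjordan_negE /crestr0 mem_set.
Qed.

Section PairingE.
Import HBNNSimple.

Lemma pairingE (R : realType) (nu : {charge set R -> \bar R})
    (P N : set R) (nuPN : hahn_decomposition nu P N) (phi : R -> R) :
  pairing nu phi = \int[jordan_pos nuPN]_(x in I01) phi x
                   - \int[jordan_neg nuPN]_(x in I01) phi x.
Proof.
have eq_integral_set (m1 m2 : set R -> \bar R) (D : set R) (g : R -> \bar R) :
    (forall A, measurable A -> m1 A = m2 A) ->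
    (\int[m1]_(x in D) g x = \int[m2]_(x in D) g x)%E.
  move=> m12; have sE (h : {nnsfun R >-> R}) : sintegral m1 h = sintegral m2 h.
    by apply: eq_fsbigr => r _; rewrite m12.
  rewrite /integral; congr (ereal_sup _ - ereal_sup _)%E;
    by apply/seteqP; split => _ [h hg <-]; exists h.
rewrite /pairing /Rintegral; congr (fine _ - fine _); apply: eq_integral_set.
- by move=> A; exact: pos_variationE.
- by move=> A; exact: neg_variationE.
Qed.

End PairingE.

Section BoundedLipschitz.
Context {R : realType}.
Implicit Types (phi : R -> R) (F G : (R -> R) -> R).

Definition sup_norm phi : \bar R := ereal_sup [set `|phi x|%:E | x in I01].

(** Equal to [+oo] when [phi] is not Lipschitz on [0,1]. *)
Definition lipschitz_const phi : \bar R :=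
  ereal_inf [set k%:E | k in [set k : R | k.-lipschitz_I01 phi]].

Definition BL_norm phi : \bar R := (sup_norm phi + lipschitz_const phi)%E.

Definition BL phi : Prop := (BL_norm phi < +oo)%E.

Definition BL_dual_norm F : \bar R :=
  ereal_sup [set `|F phi|%:E | phi in [set phi | (BL_norm phi <= 1)%E]].

Definition BL_dual F : Prop :=
  (forall (a : R) phi psi, BL phi -> BL psi ->
     F (fun x => a * phi x + psi x) = a * F phi + F psi) /\
  (BL_dual_norm F < +oo)%E.

(** The completion of M([0,1]) for the dual bounded Lipschitz norm: its closure
    in the dual of BL([0,1]). *)
Definition M_completion F : Prop :=
  BL_dual F /\
  forall e : R, 0 < e -> exists nu : {charge set R -> \bar R},
    concentrated nu /\ (BL_dual_norm (F \- pairing nu)%R <= e%:E)%E.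

End BoundedLipschitz.

Section BochnerIntegral.
Context {R : realType}.
Local Notation leb := (@lebesgue_measure R).

Record simple_map (D : set R) := SimpleMap {
  simple_size : nat ;
  simple_set : 'I_simple_size -> set R ;
  simple_val : 'I_simple_size -> (R -> R) -> R ;
  simple_setP : forall i, measurable (simple_set i) /\ simple_set i `<=` D ;
  simple_valP : forall i, M_completion (simple_val i) }.

Definition simple_eval D (u : simple_map D) (s : R) : (R -> R) -> R :=
  fun phi => \sum_(i < simple_size u) \1_(simple_set i) s * simple_val i phi.

Definition simple_integral D (u : simple_map D) : (R -> R) -> R :=
  fun phi => \sum_(i < simple_size u)
    fine (leb (simple_set i)) * simple_val i phi.

(** [g] is Bochner integrable on [D] (a set of finite Lebesgue measure), as a
    map into the completion of M([0,1]), and its integral is [J]. *)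
Definition is_bochner_integral (D : set R) (g : R -> (R -> R) -> R)
    (J : (R -> R) -> R) : Prop :=
  exists u : nat -> simple_map D,
  [/\ forall n, measurable_fun D
        (fun s => BL_dual_norm (g s \- simple_eval (u n) s)),
      (\int[leb]_(s in D) BL_dual_norm (g s \- simple_eval (u n) s)%R)%E
        @[n --> \oo] --> 0%E
    & BL_dual_norm (J \- simple_integral (u n)) @[n --> \oo] --> 0%E].

End BochnerIntegral.

Section StoppedFlow.
Context {R : realType}.
Implicit Types (v : R -> R) (t : R).

(** Derivative relative to a set, hence one-sided at the ends of an interval. *)
Definition is_derive_within (A : set R) (g : R -> R) (x l : R) : Prop :=
  (g y - g x) / (y - x) @[y --> within A x^'] --> l.

Definition solution v (x0 : R) t (x : R -> R) : Prop :=
  x 0 = x0 /\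
  forall s, s \in `[0, t] ->
    I01 (x s) /\ is_derive_within `[0, t]%classic x s (v (x s)).

Definition existence_interval v (x0 : R) : set R :=
  [set t | 0 <= t /\ exists x, solution v x0 t x].

Definition exit_time v (x0 : R) : \bar R :=
  ereal_sup [set t%:E | t in existence_interval v x0].

Definition trajectory v (x0 : R) t : R :=
  xget x0 [set y | exists2 x, solution v x0 t x & y = x t].

Definition stopped_flow v t (x0 : R) : R :=
  if `[< existence_interval v x0 t >] then trajectory v x0 t
  else trajectory v x0 (fine (exit_time v x0)).

(** For [x0] outside [0,1] there is no solution, and [stopped_flow v t x0 = x0]
    by the default value in [trajectory]. *)
Definition flow_push v t (m : set R -> \bar R) : set R -> \bar R :=
  pushforward m (stopped_flow v t).

End StoppedFlow.

Section Equation.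
Context {R : realType}.
Implicit Types (T : R) (v f : R -> R) (mu : R -> {charge set R -> \bar R}).

Definition bounded_lipschitz (A : set R) (g : R -> R) : Prop :=
  [bounded g x | x in A] /\ [lipschitz g x | x in A].

Definition piecewise_bounded_lipschitz f : Prop :=
  exists (n : nat) (a : nat -> R),
  [/\ a 0%N = 0, a n = 1,
      forall i, (i < n)%N -> a i < a i.+1
    & forall i, (i < n)%N -> bounded_lipschitz `]a i, a i.+1[%classic f].

Definition continuous_at01 f (x : R) : Prop :=
  f y @[y --> within I01 (nbhs x)] --> f x.

Definition mild_solution T v f (nu0 : {charge set R -> \bar R}) mu : Prop :=
  [/\ forall t, t \in `[0, T] -> concentrated (mu t),
      forall t, t \in `[0, T] ->
        BL_dual_norm (pairing (mu s) \- pairing (mu t))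
          @[s --> within `[0, T]%classic (nbhs t)] --> 0%E,
      exists C : R, forall t, t \in `[0, T] -> (TV_norm (mu t) <= C%:E)%E
    & forall t, t \in `[0, T] ->
        is_bochner_integral `[0, t]%classic
          (fun s => pairing (flow_push v (t - s) (density f (mu s))))
          (pairing (mu t) \- pairing (flow_push v t nu0))].

(** [psi] is C^1 on [0,1] x [0,T], with partial derivatives [psi_x], [psi_t]. *)
Definition C1_rect T (psi psi_x psi_t : R -> R -> R) : Prop :=
  let Q : set (R * R) := I01 `*` `[0, T]%classic in
  [/\ {within Q, continuous (fun p : R * R => psi p.1 p.2)},
      {within Q, continuous (fun p : R * R => psi_x p.1 p.2)},
      {within Q, continuous (fun p : R * R => psi_t p.1 p.2)}
    & forall x t, Q (x, t) ->
        is_derive_within I01 (fun y => psi y t) x (psi_x x t) /\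
        is_derive_within `[0, T]%classic (psi x) t (psi_t x t)].

Definition test_function T (psi psi_x psi_t : R -> R -> R) : Prop :=
  C1_rect T psi psi_x psi_t /\
  forall t, t \in `[0, T] -> psi_x 0 t = 0 /\ psi_x 1 t = 0.

(** The first two clauses say that the time integrals exist. *)
Definition weak_solution T v f (nu0 : {charge set R -> \bar R}) mu : Prop :=
  forall psi psi_x psi_t, test_function T psi psi_x psi_t ->
  let transport t := pairing (mu t) (fun x => psi_t x t + psi_x x t * v x) in
  let growth t := pairing (density f (mu t)) (fun x => psi x t) in
  [/\ lebesgue_measure.-integrable `[0, T]%classic (EFin \o transport),
      lebesgue_measure.-integrable `[0, T]%classic (EFin \o growth)
    & pairing (mu T) (fun x => psi x T) - pairing nu0 (fun x => psi x 0)
      = \int[lebesgue_measure]_(t in `[0, T]) transport t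
        + \int[lebesgue_measure]_(t in `[0, T]) growth t].

End Equation.

(* Main.v *)
From HB Require Import structures.
Require Import Defs.
From mathcomp Require Import all_boot all_order all_algebra.
From mathcomp Require Import all_classical all_reals all_analysis measurable_realfun.
From mathcomp Require Import ring lra.
Import Order.TTheory GRing.Theory Num.Theory.
Import numFieldNormedType.Exports.

Set Implicit Arguments.
Unset Strict Implicit.
Unset Printing Implicit Defensive.

Local Open Scope classical_set_scope.
Local Open Scope ring_scope.

(** Why a mild solution is a weak solution.

    Let Psi_t be the stopped flow and psi a test function, and put
    A = psi_t + psi_x v. For x in [0,1] the function t |-> psi(Psi_t x, t) has
    derivative A(Psi_t x, t): before the exit this is the chain rule, and
    afterwards the point rests at an end of the interval, where psi_x = 0. The
    difference quotients converge uniformly in x and t, since near the exit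
    psi_x is already small ([test_function_along_flow]).

    Tested against a continuous phi, the variation of constants formula reads
      <mu_t, phi> = <nu_0, phi o Psi_t>
                    + int_0^t <mu_s, f . (phi o Psi_(t-s))> ds
    ([mild_pairing]). Apply it at time t + h to psi(., t+h), at time t to
    psi(., t), and at time t to A(., t), and subtract: up to o(h), uniformly
    in t, what is left is
      <mu_(t+h), psi(., t+h)> - <mu_t, psi(., t)>
         = h <mu_t, A(., t)> + int_t^(t+h) <mu_s, f psi(., s)> ds.
    So <mu_t, psi(., t)> minus the primitives of the two integrands on the right
    of the weak formulation has increments o(h), and is constant
    ([uniform_little_o_constant]).

    Three ingredients support this. The flow: Picard iteration solves the
    equation for the field extended by constants outside [0,1]
    ([ode_existence]); a solution that leaves [0,1] does not return, so the
    stopped flow is the projection of that flow onto [0,1]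
    ([stopped_flow_regular]). Signed measures: push-forwards and densities are
    identified as functionals of Daniell type ([pairing_daniell]). Time
    dependence: f is a bounded pointwise limit of continuous functions f_n
    ([piecewise_approx]), and s |-> <mu_s, f_n phi_s> is continuous for a
    continuous curve phi, because mu is continuous in the dual bounded
    Lipschitz norm and bounded in total variation; hence s |-> <mu_s, f phi_s>
    is Borel measurable and bounded ([pairing_density_measurable]), as the
    passage from the Bochner integral to integrals of real functions
    requires. *)

(** * Integration against a signed measure on [0,1] *)

(** Only the restriction to [0,1] matters, as for [pairing]. *)
Definition bdd_meas01 (R : realType) (phi : R -> R) : Prop :=
  measurable_fun I01 phi /\ exists M, forall x, I01 x -> `|phi x| <= M.

Lemma measurable_I01 (R : realType) : measurable (@I01 R).
Proof. exact: measurable_itv. Qed.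

Section BddMeas01.
Context {R : realType}.
Implicit Types (phi psi : R -> R).

Lemma bdd_meas01_measurable phi : bdd_meas01 phi -> measurable_fun I01 phi.
Proof. by case. Qed.

Lemma bdd_meas01_cst (c : R) : bdd_meas01 (fun=> c).
Proof. by split; [exact: measurable_cst | exists `|c|]. Qed.

Lemma bdd_meas01D phi psi :
  bdd_meas01 phi -> bdd_meas01 psi -> bdd_meas01 (fun x => phi x + psi x).
Proof.
move=> [m1 [M1 h1]] [m2 [M2 h2]]; split; first exact: measurable_funD.
by exists (M1 + M2) => x Ix; rewrite (le_trans (ler_normD _ _))// lerD ?h1 ?h2.
Qed.

Lemma bdd_meas01M phi psi :
  bdd_meas01 phi -> bdd_meas01 psi -> bdd_meas01 (fun x => phi x * psi x).
Proof.
move=> [m1 [M1 h1]] [m2 [M2 h2]]; split; first exact: measurable_funM.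
by exists (M1 * M2) => x Ix; rewrite normrM ler_pM ?h1 ?h2.
Qed.

Lemma bdd_meas01Z (c : R) phi :
  bdd_meas01 phi -> bdd_meas01 (fun x => c * phi x).
Proof. by move=> h; apply: bdd_meas01M => //; exact: bdd_meas01_cst. Qed.

Lemma bdd_meas01B phi psi :
  bdd_meas01 phi -> bdd_meas01 psi -> bdd_meas01 (fun x => phi x - psi x).
Proof.
move=> h1 /(bdd_meas01Z (-1)) h2.
under eq_fun do rewrite -mulN1r.
exact: bdd_meas01D.
Qed.

Lemma bdd_meas01_indic (A : set R) : measurable A -> bdd_meas01 (\1_A : R -> R).
Proof.
move=> mA; split; first exact: measurable_indic.
by exists 1 => x _; rewrite indicE; case: (_ \in _); rewrite ?normr1 ?normr0.
Qed.

Lemma bdd_meas01_cts phi : continuous phi -> bdd_meas01 phi.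
Proof.
move=> cphi; have cI : {within I01, continuous phi} by exact: continuous_subspaceT.
split.
  by apply: subspace_continuous_measurable_fun => //; exact: measurable_I01.
have [c _ hc] := @EVT_max R (fun x => `|phi x|) 0 1 ler01
  (continuous_subspaceT (fun x => continuous_comp (cphi x) (@norm_continuous _ _ _))).
by exists `|phi c|.
Qed.

Lemma bdd_meas01_eq phi psi :
  {in I01, phi =1 psi} -> bdd_meas01 phi -> bdd_meas01 psi.
Proof.
move=> e [m [M h]]; split.
  by apply: (@eq_measurable_fun _ _ _ _ I01 phi).
by exists M => x Ix; rewrite -e ?inE ?h.
Qed.

End BddMeas01.

Section BoundedConvergence.
Context {R : realType} (m : {finite_measure set R -> \bar R}).
Implicit Types (phi psi : R -> R).

Lemma bdd_meas01_integrable phi :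
  bdd_meas01 phi -> m.-integrable I01 (EFin \o phi).
Proof.
move=> [mphi [M h]]; apply: measurable_bounded_integrable => //.
- exact: measurable_I01.
- by rewrite ltey_eq fin_num_measure //; exact: measurable_I01.
- exists M; split; first exact: num_real.
  by move=> x Mx y Iy /=; rewrite (le_trans (h _ Iy))// ltW.
Qed.

Lemma Rintegral_bounded_cvg (phi_ : nat -> R -> R) phi (M : R) :
  (forall n, measurable_fun I01 (phi_ n)) ->
  (forall n x, I01 x -> `|phi_ n x| <= M) ->
  (forall x, I01 x -> phi_ ^~ x @ \oo --> phi x) ->
  bdd_meas01 phi /\
  \int[m]_(x in I01) phi_ n x @[n --> \oo] --> \int[m]_(x in I01) phi x.
Proof.
move=> mphi_ hM hcv.
have bphi : bdd_meas01 phi.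
  split; first by apply: (@measurable_fun_cvg _ _ _ _ phi_) => //; exact: measurable_I01.
  exists M => x Ix; have := hcv x Ix => /cvg_norm h.
  apply: (@closed_cvg _ _ _ _ _ [set y | y <= M] _ _ _ h).
  - exact: closed_le.
  - by apply: nearW => n; exact: hM.
split => //.
have [] := @dominated_convergence _ _ _ m _ (@measurable_I01 R)
   (fun n => EFin \o phi_ n) (EFin \o phi) (cst M%:E).
- by move=> n; apply/measurable_EFinP.
- by apply/measurable_EFinP; case: bphi.
- by apply: aeW => x Ix; apply/cvg_EFin; [exact: nearW|exact: hcv].
- by apply: (bdd_meas01_integrable (bdd_meas01_cst M)).
- by apply: aeW => x n Ix; rewrite lee_fin hM.
move=> _ _ h.
rewrite /Rintegral; apply: fine_cvg; rewrite fineK; first exact: h.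
by apply: integrable_fin_num; [exact: measurable_I01|exact: bdd_meas01_integrable].
Qed.

End BoundedConvergence.

(** Daniell's notion of an integral. Signed integrals have this property, it is
    inherited under densities and changes of variables, and a functional that
    has it is determined by its values on indicators: measures given by such
    operations are compared through it, rather than through their Jordan
    decompositions. *)
Definition daniell (R : realType) (L : (R -> R) -> R) : Prop :=
  [/\ forall (a : R) phi psi, bdd_meas01 phi -> bdd_meas01 psi ->
        L (fun x => a * phi x + psi x) = a * L phi + L psi,
      forall phi psi, {in I01, phi =1 psi} -> L phi = L psi
    & forall (phi_ : nat -> R -> R) phi (M : R),
        (forall n, measurable_fun I01 (phi_ n)) ->
        (forall n x, I01 x -> `|phi_ n x| <= M) ->
        (forall x, I01 x -> phi_ n x @[n --> \oo] --> phi x) ->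
        L (phi_ n) @[n --> \oo] --> L phi].

Section Daniell.
Context {R : realType}.
Implicit Types (L : (R -> R) -> R) (phi psi : R -> R).

Lemma daniell_Rintegral (m : {finite_measure set R -> \bar R}) :
  daniell (fun phi => \int[m]_(x in I01) phi x).
Proof.
split.
- move=> a phi psi bphi bpsi; have mI := @measurable_I01 R.
  have iphi := bdd_meas01_integrable m bphi.
  have iaphi := bdd_meas01_integrable m (bdd_meas01Z a bphi).
  have ipsi := bdd_meas01_integrable m bpsi.
  by rewrite RintegralD// RintegralZl.
- by move=> phi psi e; apply: eq_Rintegral.
- move=> phi_ phi M mphi hM hcv.
  exact: (Rintegral_bounded_cvg m mphi hM hcv).2.
Qed.

Lemma daniellB L1 L2 : daniell L1 -> daniell L2 ->
  daniell (fun phi => L1 phi - L2 phi).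
Proof.
move=> [l1 e1 c1] [l2 e2 c2]; split.
- by move=> a phi psi b1 b2; rewrite l1// l2//; ring.
- by move=> phi psi e; rewrite (e1 _ _ e) (e2 _ _ e).
- by move=> phi_ phi M h1 h2 h3; exact: (cvgB (c1 _ _ _ h1 h2 h3) (c2 _ _ _ h1 h2 h3)).
Qed.

Lemma daniell_pairing (nu : {charge set R -> \bar R}) : daniell (pairing nu).
Proof.
have [P [N PN]] := Hahn_decomposition nu.
have -> : pairing nu = (fun phi => \int[jordan_pos PN]_(x in I01) phi x
                   - \int[jordan_neg PN]_(x in I01) phi x).
  by apply/funext => phi; exact: pairingE.
by apply: daniellB; exact: daniell_Rintegral.
Qed.

Lemma bdd_meas01_comp phi (Psi : R -> R) : bdd_meas01 phi ->
  measurable_fun I01 Psi -> (forall x, I01 x -> I01 (Psi x)) ->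
  bdd_meas01 (fun x => phi (Psi x)).
Proof.
move=> [mphi [M h]] mP IP; split; last by exists M => x /IP; exact: h.
apply: (@measurable_comp _ _ _ _ _ _ I01) => //; first exact: measurable_I01.
by move=> _ [x Ix <-]; exact: IP.
Qed.

Lemma daniell_density_comp L (f Psi : R -> R) : daniell L -> bdd_meas01 f ->
  measurable_fun I01 Psi -> (forall x, I01 x -> I01 (Psi x)) ->
  daniell (fun phi => L (fun x => f x * phi (Psi x))).
Proof.
move=> [l e c] bf mP IP; split.
- move=> a phi psi bphi bpsi.
  rewrite -l; [|exact: bdd_meas01M bf (bdd_meas01_comp bphi mP IP)
               |exact: bdd_meas01M bf (bdd_meas01_comp bpsi mP IP)].
  by congr L; apply/funext => x; ring.
- move=> phi psi ee; apply: e => x; rewrite inE => Ix.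
  by rewrite ee// inE; exact: IP.
- move=> phi_ phi M mphi hM hcv; case: (bf) => mf [K hK].
  apply: (c _ _ (K * M)).
  + move=> n; apply: measurable_funM => //.
    apply: (@measurable_comp _ _ _ _ _ _ I01) => //; first exact: measurable_I01.
    by move=> _ [x Ix <-]; exact: IP.
  + by move=> n x Ix; rewrite normrM ler_pM ?hK// hM//; exact: IP.
  + by move=> x Ix; apply: cvgMr; exact: hcv (IP _ Ix).
Qed.

Section DaniellTheory.
Variables (L : (R -> R) -> R) (dL : daniell L).

Lemma daniell_eq phi psi : {in I01, phi =1 psi} -> L phi = L psi.
Proof. by case: dL => _ + _; exact. Qed.

Lemma daniell0 : L (fun=> 0) = 0.
Proof.
case: dL => l _ _; have := l (-1) _ _ (bdd_meas01_cst 0) (bdd_meas01_cst 0).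
by rewrite mulr0 addr0 => ->; ring.
Qed.

Lemma daniellD phi psi : bdd_meas01 phi -> bdd_meas01 psi ->
  L (fun x => phi x + psi x) = L phi + L psi.
Proof.
move=> b1 b2; case: dL => l e _; rewrite -[L phi in RHS]mul1r -l//.
by apply: e => x _; rewrite mul1r.
Qed.

Lemma daniellZ (a : R) phi : bdd_meas01 phi -> L (fun x => a * phi x) = a * L phi.
Proof.
move=> b1; case: dL => l e _.
have := l a _ _ b1 (bdd_meas01_cst 0); rewrite daniell0 addr0 => <-.
by apply: e => x _; rewrite addr0.
Qed.

Lemma daniell_sub phi psi : bdd_meas01 phi -> bdd_meas01 psi ->
  L (fun x => phi x - psi x) = L phi - L psi.
Proof.
move=> b1 b2; rewrite -mulN1r -daniellZ// -daniellD//; last exact: bdd_meas01Z.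
by apply: daniell_eq => x _; rewrite mulN1r.
Qed.

Lemma bdd_meas01_sum (N : nat) (g : nat -> R -> R) :
  (forall k, (k < N)%N -> bdd_meas01 (g k)) -> bdd_meas01 (fun x => \sum_(k < N) g k x).
Proof.
elim: N => [|N IH] h.
  by under eq_fun do rewrite big_ord0; exact: bdd_meas01_cst.
under eq_fun do rewrite big_ord_recr/=.
by apply: bdd_meas01D; [apply: IH => k kN; apply: h; exact: ltnW|exact: h].
Qed.

Lemma daniell_sum (N : nat) (g : nat -> R -> R) :
  (forall k, (k < N)%N -> bdd_meas01 (g k)) ->
  L (fun x => \sum_(k < N) g k x) = \sum_(k < N) L (g k).
Proof.
elim: N => [|N IH] h.
  by under eq_fun do rewrite big_ord0; rewrite big_ord0 daniell0.
under eq_fun do rewrite big_ord_recr/=.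
have h' k : (k < N)%N -> bdd_meas01 (g k) by move=> kN; apply: h; exact: ltnW.
rewrite big_ord_recr/= daniellD ?IH//; first exact: bdd_meas01_sum.
exact: h.
Qed.

Lemma daniell_cvg (phi_ : nat -> R -> R) phi (M : R) :
  (forall n, measurable_fun I01 (phi_ n)) ->
  (forall n x, I01 x -> `|phi_ n x| <= M) ->
  (forall x, I01 x -> phi_ n x @[n --> \oo] --> phi x) ->
  L (phi_ n) @[n --> \oo] --> L phi.
Proof. by case: dL => _ _; exact. Qed.

End DaniellTheory.

(** A nonnegative bounded measurable function is a bounded limit of simple
    functions; adding a constant reduces to that case. *)
Lemma daniell_ext L1 L2 : daniell L1 -> daniell L2 ->
  (forall A, measurable A -> L1 \1_A = L2 \1_A) ->
  forall phi, bdd_meas01 phi -> L1 phi = L2 phi.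
Proof.
move=> d1 d2 e phi bphi.
have pos psi : bdd_meas01 psi -> (forall x, I01 x -> 0 <= psi x) -> L1 psi = L2 psi.
  move=> bpsi psi0.
  have mpsi : measurable_fun I01 (EFin \o psi) by apply/measurable_EFinP; case: bpsi.
  pose a n := approx I01 (EFin \o psi) n.
  have ba n : bdd_meas01 (a n) /\ L1 (a n) = L2 (a n).
    have mA k : measurable (dyadic_approx I01 (EFin \o psi) n k).
      rewrite /dyadic_approx; case: ifPn => // _; rewrite -preimage_comp.
      apply: mpsi; first exact: measurable_I01.
      by apply/measurable_image_EFin; exact: measurable_itv.
    have mB : measurable (integer_approx I01 (EFin \o psi) n).
      by apply: emeasurable_fun_c_infty => //; exact: measurable_I01.
    have bA k : bdd_meas01 (fun x => k%:R * 2 ^- n *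
       (\1_(dyadic_approx I01 (EFin \o psi) n k) x) : R).
      exact/bdd_meas01Z/bdd_meas01_indic.
    have bB : bdd_meas01 (fun x => n%:R * (\1_(integer_approx I01 (EFin \o psi) n) x) : R).
      exact/bdd_meas01Z/bdd_meas01_indic.
    have bS : bdd_meas01 (fun x => \sum_(k < n * 2 ^ n) k%:R * 2 ^- n *
       (\1_(dyadic_approx I01 (EFin \o psi) n k) x) : R).
      by apply: (@bdd_meas01_sum _ (fun k x => k%:R * 2 ^- n *
         (\1_(dyadic_approx I01 (EFin \o psi) n k) x))).
    split; first exact: bdd_meas01D.
    have E L : daniell L -> L (a n) = \sum_(k < n * 2 ^ n) k%:R * 2 ^- n *
         L \1_(dyadic_approx I01 (EFin \o psi) n k)
         + n%:R * L \1_(integer_approx I01 (EFin \o psi) n).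
      move=> dL; rewrite [LHS](daniellD dL)//.
      rewrite (@daniell_sum _ dL _ (fun k x => k%:R * 2 ^- n *
         (\1_(dyadic_approx I01 (EFin \o psi) n k) x)))//.
      congr (_ + _); last by rewrite daniellZ//; exact: bdd_meas01_indic.
      by apply: eq_bigr => k _; rewrite daniellZ//; exact: bdd_meas01_indic.
    by rewrite (E _ d1) (E _ d2) e//; congr (_ + _); apply: eq_bigr => k _; rewrite e.
  case: (bpsi) => _ [M hM].
  have cv L : daniell L -> L (a n) @[n --> \oo] --> L psi.
    move=> dL; apply: (daniell_cvg dL (M := M)).
    - by move=> n; case: (ba n) => -[].
    - move=> n x Ix; have ps0 y : I01 y -> (0 <= (EFin \o psi) y)%E.
        by move=> Iy; rewrite lee_fin psi0.
      have le1 := @le_approx _ _ _ _ _ n x ps0 Ix.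
      rewrite ger0_norm.
        by rewrite lee_fin in le1; rewrite (le_trans le1)// (le_trans (ler_norm _))// hM.
      apply: addr_ge0; last by apply: mulr_ge0; rewrite ?indicE.
      apply: sumr_ge0 => i _; apply: mulr_ge0; last by rewrite indicE.
      by apply: mulr_ge0; rewrite ?invr_ge0 ?exprn_ge0.
    - move=> x Ix; apply: (@cvg_approx _ _ _ I01 (EFin \o psi)) => //=; rewrite ?ltry//.
  apply: (@cvg_unique _ _ (L1 (a n) @[n --> \oo])); first exact: norm_hausdorff.
    exact: cv.
  have -> : (fun n => L1 (a n)) = (fun n => L2 (a n)) by apply/funext => n; case: (ba n).
  exact: cv.
case: (bphi) => mphi [M hM].
have bM : bdd_meas01 (fun x => phi x + M) by apply: bdd_meas01D => //; exact: bdd_meas01_cst.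
have := pos _ bM; rewrite !daniellD//; try exact: bdd_meas01_cst.
have -> : L1 (fun=> M) = L2 (fun=> M).
  have [M0|M0] := leP 0 M; first by apply: pos => //; exact: bdd_meas01_cst.
  have H0 := hM 0; have : `|phi 0| <= M by apply: H0; rewrite /I01/= in_itv/= lexx ler01.
  by move=> /(le_trans (normr_ge0 _)); rewrite leNgt M0.
move=> h; apply: (addIr (L2 (fun=> M))); apply: h => x Ix.
by have := hM _ Ix; rewrite ler_norml => /andP[+ _]; rewrite -lerBlDr sub0r.
Qed.

End Daniell.

Section DaniellCharge.
Context {R : realType} (L : (R -> R) -> R) (dL : daniell L).

Definition daniell_charge (A : set R) : \bar R := (L \1_A)%:E.

Let charge_set0 : daniell_charge set0 = 0%E.
Proof. by rewrite /daniell_charge indic0 (daniell0 dL). Qed.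

Let charge_fin A : measurable A -> daniell_charge A \is a fin_num.
Proof. by []. Qed.

Let charge_sigma : semi_sigma_additive daniell_charge.
Proof.
move=> F mF tF mUF.
have -> : (fun n => (\sum_(0 <= i < n) daniell_charge (F i))%E) =
          (fun n => (L (\1_(\big[setU/set0]_(i < n) F i)))%:E).
  apply/funext => n; rewrite big_mkord.
  rewrite /daniell_charge sumEFin; congr EFin.
  rewrite -(@daniell_sum _ _ dL n (fun k => \1_(F k))); last first.
    by move=> k _; exact: bdd_meas01_indic.
  congr L; apply/funext => x.
  elim: n => [|n IH]; first by rewrite !big_ord0 indicE in_set0.
  rewrite !big_ord_recr/= IH !indicE in_setU.
  case: (boolP (x \in F n)) => [/set_mem Fn|_]; last by rewrite orbF addr0.
  case: (boolP (x \in _)) => [/set_mem|_]; last by rewrite add0r.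
  rewrite -bigcup_mkord => -[k /= kn Fk].
  move/trivIsetP : tF => /(_ k n Logic.I Logic.I); rewrite neq_ltn kn => /(_ isT).
  by move/seteqP => -[/(_ x) + _]; case.
apply: cvg_EFin; first by apply: nearW.
rewrite /comp /=.
apply: (daniell_cvg dL (M := 1)).
- by move=> n; apply: measurable_indic; exact: bigsetU_measurable.
- by move=> n x _; rewrite indicE; case: (_ \in _); rewrite ?normr1 ?normr0.
- move=> x _; have [[k _ Fk]|nx] := pselect ((\bigcup_n F n) x).
    apply: cvg_near_cst; exists k.+1 => // n /= kn.
    rewrite !indicE !mem_set//; first by exists k.
    by rewrite -bigcup_mkord; exists k.
  rewrite indicE memNset//; apply: cvg_near_cst; apply: nearW => n /=.
  rewrite indicE memNset// -bigcup_mkord => -[k _ Fk]; apply: nx.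
  by exists k.
Qed.

HB.instance Definition _ := isCharge.Build _ _ _ daniell_charge
  charge_set0 charge_fin charge_sigma.

End DaniellCharge.

Section Representation.
Context {R : realType}.
Implicit Types (L : (R -> R) -> R) (m : set R -> \bar R).

Lemma eq_pairing m1 m2 : (forall A, measurable A -> m1 A = m2 A) ->
  pairing m1 = pairing m2.
Proof.
move=> e; have posE (a b : set R -> \bar R) : (forall A, measurable A -> a A = b A) ->
    pos_variation a = pos_variation b.
  move=> ab; apply/funext => A; congr ereal_sup.
  by apply/seteqP; split => _ [B [mB BA] <-]; exists B => //; rewrite ab.
apply/funext => phi; rewrite /pairing (posE _ _ e) /neg_variation.
by rewrite (@posE (fun A => - m1 A)%E (fun A => - m2 A)%E)// => A mA; rewrite e.
Qed.

Lemma pairing_indic (nu : {charge set R -> \bar R}) A : measurable A ->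
  (pairing nu \1_A)%:E = nu (A `&` I01).
Proof.
move=> mA; have [P [N PN]] := Hahn_decomposition nu.
rewrite (pairingE PN) EFinB /Rintegral.
have mAI : measurable (A `&` I01) by apply: measurableI => //; exact: measurable_I01.
have mI := @measurable_I01 R.
rewrite (integral_indic (jordan_pos PN) mI mA) (integral_indic (jordan_neg PN) mI mA).
have fin (m : {finite_measure set R -> \bar R}) : (fine (m (A `&` I01)))%:E = m (A `&` I01).
  by rewrite fineK// fin_num_measure.
by rewrite !fin [RHS](jordan_decomp PN mAI) /cadd/= /cscale EFinN mulN1e.
Qed.

Lemma pairing_bound (nu : {charge set R -> \bar R}) : exists2 C, 0 <= C &
  forall phi M, bdd_meas01 phi -> (forall x, I01 x -> `|phi x| <= M) ->
    `|pairing nu phi| <= C * M.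
Proof.
have [P [N PN]] := Hahn_decomposition nu; have mI := @measurable_I01 R.
exists (fine (jordan_pos PN I01) + fine (jordan_neg PN I01)).
  by rewrite addr_ge0// fine_ge0.
move=> phi M bphi hM; rewrite (pairingE PN).
have one (m : {finite_measure set R -> \bar R}) :
    `|\int[m]_(x in I01) phi x| <= fine (m I01) * M.
  have ip := bdd_meas01_integrable m bphi.
  apply: (le_trans (le_normr_Rintegral mI ip)).
  rewrite mulrC -Rintegral_cst//; apply: le_Rintegral => //.
    exact: integrable_norm.
  exact: (bdd_meas01_integrable m (bdd_meas01_cst M)).
by apply: (le_trans (ler_normB _ _)); rewrite mulrDl; apply: lerD; exact: one.
Qed.

(** A signed measure on [0,1] is determined by its values on measurable sets,
    so a functional that matches it on indicators is its integral. This is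
    where changes of variables and densities come from. *)
Lemma pairing_daniell m L : daniell L ->
  (forall A, measurable A -> m A = (L \1_A)%:E) ->
  forall phi, bdd_meas01 phi -> pairing m phi = L phi.
Proof.
move=> dL mE phi bphi.
have -> : pairing m = pairing (daniell_charge L) by exact: eq_pairing.
apply: (daniell_ext (daniell_pairing _) dL) => // A mA.
apply: EFin_inj; rewrite (@pairing_indic (daniell_charge L : {charge set R -> \bar R}))//.
congr EFin; apply: daniell_eq => // x; rewrite inE => Ix.
by rewrite !indicE in_setI (mem_set Ix) andbT.
Qed.

End Representation.

(** * Integrals over compact intervals *)

Section IntegralItv.
Context {R : realType}.
Local Notation leb := (@lebesgue_measure R).
Implicit Types (g : R -> R) (a b c : R).

Lemma integrable_itv_bounded g a b c : measurable_fun `[a, b] g ->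
  (forall s, s \in `[a, b] -> `|g s| <= c) -> leb.-integrable `[a, b] (EFin \o g).
Proof.
move=> mg h; apply: measurable_bounded_integrable => //.
- by rewrite /= lebesgue_measure_itv/= lte_fin; case: ifP; rewrite ?ltry // -EFinB ltry.
- exists c; split; first exact: num_real.
  by move=> x cx y yab /=; rewrite (le_trans (h _ yab))// ltW.
Qed.

Lemma Rintegral_itv_cst a b c : a <= b -> \int[leb]_(x in `[a, b]) c = c * (b - a).
Proof.
move=> ab; rewrite Rintegral_cst//= lebesgue_measure_itv/= lte_fin.
move: ab; rewrite le_eqVlt => /predU1P[->|ab]; last by rewrite ab.
by rewrite ltxx subrr.
Qed.

Lemma Rintegral_itv_bound g a b c : a <= b -> measurable_fun `[a, b] g ->
  (forall s, s \in `[a, b] -> `|g s| <= c) -> `|\int[leb]_(x in `[a, b]) g x| <= c * (b - a).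
Proof.
move=> ab mg h; have ig := integrable_itv_bounded mg h.
rewrite (le_trans (le_normr_Rintegral _ _))// -Rintegral_itv_cst//.
apply: le_Rintegral => //.
- apply: (integrable_itv_bounded (c := c)); first exact: measurableT_comp.
  by move=> s sab; rewrite normr_id h.
- apply: (integrable_itv_bounded (c := `|c|)); first exact: measurable_cst.
  by [].
Qed.

Lemma Rintegral_itv_chasles g a b c : a <= b -> b <= c ->
  leb.-integrable `[a, c] (EFin \o g) ->
  \int[leb]_(x in `[a, c]) g x = \int[leb]_(x in `[a, b]) g x + \int[leb]_(x in `[b, c]) g x.
Proof.
move=> ab bc ig.
have ibc : leb.-integrable `]b, c] (EFin \o g).
  apply: integrableS ig => //; apply: subset_itvr; rewrite bnd_simp//.
have := @Rintegral_itvB R g (BLeft a) (BRight c) b ig.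
rewrite !bnd_simp => /(_ ab bc) h.
by rewrite -(Rintegral_itv_obnd_cbnd ibc) -h addrC subrK.
Qed.

End IntegralItv.

(** * The flow of a Lipschitz field on the line *)

(** Paths along which one Euler step of length [h] errs by O(h^2), uniformly in
    time. For a bounded Lipschitz field this is equivalent to solving the
    equation, and unlike differentiability it passes to pointwise limits. *)
Definition euler_path (R : realType) (V X : R -> R) (C : R) : Prop :=
  forall t h, 0 <= t -> 0 <= h -> `|X (t + h) - X t - h * V (X t)| <= C * h ^+ 2.

Section Picard.
Context {R : realType}.
Local Notation leb := (@lebesgue_measure R).
Variables (V : R -> R) (L M : R).
Hypothesis L_gt0 : 0 < L.
Hypothesis VL : forall x y, `|V x - V y| <= L * `|x - y|.
Hypothesis VM : forall x, `|V x| <= M.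

Definition lip_path (y : R -> R) := forall s t, `|y s - y t| <= M * `|s - t|.

Lemma lipschitz_continuous (g : R -> R) (k : R) :
  (forall x y, `|g x - g y| <= k * `|x - y|) -> continuous g.
Proof.
move=> h x; apply/cvgrPdist_le => e e0.
have k0 : 0 <= k by have := h 0 1; rewrite sub0r normrN1 mulr1; exact/le_trans.
apply/nbhs_ballP; exists (e / (k + 1)) => /=; first by rewrite divr_gt0// ltr_wpDl.
move=> y; rewrite /ball/= => xy; rewrite (le_trans (h _ _))//.
rewrite (@le_trans _ _ ((k + 1) * `|x - y|))//.
  by rewrite ler_wpM2r// lerDl.
by rewrite mulrC -ler_pdivlMr ?ltr_wpDl// ltW.
Qed.

Let cV : continuous V. Proof. exact: lipschitz_continuous VL. Qed.

Let picard_int (y : R -> R) (a b : R) : lip_path y ->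
  leb.-integrable `[a, b] (EFin \o (V \o y)).
Proof.
move=> ly; apply: (integrable_itv_bounded (c := M)) => [|s _]; last exact: VM.
apply: measurable_funTS; apply: continuous_measurable_fun => x.
apply: continuous_comp; last exact: cV.
exact: (lipschitz_continuous ly).
Qed.

Definition picard_step (x0 : R) (y : R -> R) (t : R) : R :=
  x0 + \int[leb]_(s in `[0, Num.max 0 t]) V (y s).

Lemma picard_stepB x0 y a b : lip_path y -> 0 <= a -> a <= b ->
  picard_step x0 y b - picard_step x0 y a = \int[leb]_(s in `[a, b]) V (y s).
Proof.
move=> ly a0 ab; have b0 := le_trans a0 ab.
rewrite /picard_step (max_r a0) (max_r b0).
rewrite (@Rintegral_itv_chasles _ (V \o y) 0 a b)//; last exact: picard_int.
by rewrite /comp; ring.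
Qed.

Lemma picard_step_lip x0 y : lip_path y -> lip_path (picard_step x0 y).
Proof.
move=> ly.
have pos a b : 0 <= a -> a <= b ->
    `|picard_step x0 y b - picard_step x0 y a| <= M * (b - a).
  move=> a0 ab; rewrite picard_stepB//; apply: Rintegral_itv_bound => //.
  by have /integrableP[/measurable_EFinP + _] := picard_int a b ly.
have M0 : 0 <= M by exact: le_trans (VM 0).
have mx a : picard_step x0 y (Num.max 0 a) = picard_step x0 y a.
  by rewrite /picard_step maxA maxxx.
move=> s t; wlog st : s t / s <= t.
  by move=> h; have [/h//|/ltW/h] := leP s t; rewrite distrC (distrC t).
rewrite distrC (distrC s) -mx -(mx s) (ger0_norm (_ : 0 <= t - s)) ?subr_ge0//.
apply: (@le_trans _ _ (M * (Num.max 0 t - Num.max 0 s))).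
  apply: pos; first by rewrite le_max lexx.
  by rewrite ge_max !le_max lexx st orbT.
apply: ler_wpM2l => //.
by case: (leP 0 s) => hs; case: (leP 0 t) => ht; lra.
Qed.

Lemma picard_step_euler x0 y : lip_path y -> forall t h, 0 <= t -> 0 <= h ->
  `|picard_step x0 y (t + h) - picard_step x0 y t - h * V (y t)| <= L * M * h ^+ 2.
Proof.
move=> ly t h t0 h0; rewrite picard_stepB ?lerDl//.
have tth : t <= t + h by rewrite lerDl.
have -> : h * V (y t) = \int[leb]_(s in `[t, t + h]) V (y t).
  by rewrite Rintegral_itv_cst//; ring.
have i1 := picard_int t (t + h) ly.
have i2 : leb.-integrable `[t, t + h] (EFin \o cst (V (y t))).
  by apply: (integrable_itv_bounded (c := M)) => // s _; exact: VM.
rewrite -RintegralB//.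
rewrite (_ : L * M * h ^+ 2 = (L * (M * h)) * (t + h - t)); last by ring.
apply: Rintegral_itv_bound => //.
  apply: measurable_funB; last by change (measurable_fun `[t, t + h] (cst (V (y t)))).
  by have /integrableP[/measurable_EFinP + _] := i1.
move=> s; rewrite in_itv/= => /andP[ts sth].
have M0 : 0 <= M by exact: le_trans (VM 0).
apply: (le_trans (VL _ _)); apply: ler_wpM2l; first exact: ltW.
apply: (le_trans (ly _ _)); apply: ler_wpM2l => //.
by rewrite ger0_norm; lra.
Qed.

Lemma expR_integral (a t : R) : 0 < a -> 0 <= t ->
  \int[leb]_(s in `[0, t]) expR (a * s) = (expR (a * t) - 1) / a.
Proof.
move=> a0; rewrite le_eqVlt => /predU1P[<-|t0].
  by rewrite mulr0 expR0 subrr mul0r set_itv1 Rintegral_set1.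
have dF (x : R) : is_derive x 1 (fun s => expR (a * s) / a) (expR (a * x)).
  apply: is_derive_eq; rewrite /GRing.scale/=; field; exact: lt0r_neq0.
rewrite /Rintegral (@continuous_FTC2 _ _ (fun s => expR (a * s) / a) 0 t t0).
- by rewrite mulr0 expR0 -EFinB/= mulrBl.
- apply: continuous_subspaceT => x; apply: continuous_comp; last exact: continuous_expR.
  exact: mulrl_continuous.
- have cF : continuous (fun s => expR (a * s) / a).
    by move=> x; apply/differentiable_continuous/derivable1_diffP.
  split.
  + by move=> x _.
  + exact/cvg_at_right_filter/cF.
  + exact/cvg_at_left_filter/cF.
- by move=> x _; rewrite derive1E derive_val.
Qed.

Fixpoint picard (x0 : R) (n : nat) : R -> R :=
  if n is n'.+1 then picard_step x0 (picard x0 n') else cst x0.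

Lemma picard_lip x0 n : lip_path (picard x0 n).
Proof.
elim: n => [|n IH]; last exact: picard_step_lip.
by move=> s t; rewrite subrr normr0 mulr_ge0//; exact: le_trans (VM 0).
Qed.

(** The weight exp(2Lt) makes the Picard map a contraction of ratio 1/2 on
    every horizon at once. *)
Lemma picard_contract x0 n t : 0 <= t ->
  `|picard x0 n.+1 t - picard x0 n t| <= M / (2 * L) * expR (2 * L * t) * 2^-1 ^+ n.
Proof.
have M0 : 0 <= M by exact: le_trans (VM 0).
have L0 := L_gt0; have L2 : 0 < 2 * L by rewrite mulr_gt0.
elim: n t => [|n IH] t t0.
  rewrite expr0 mulr1 /= /picard_step (max_r t0) addrAC subrr add0r.
  apply: (@le_trans _ _ (M * (t - 0))).
    apply: Rintegral_itv_bound => //.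
    by change (measurable_fun `[0, t] (cst (V x0))).
  rewrite subr0 -mulrA ler_wpM2l// mulrC ler_pdivlMr// mulrC.
  by have := expR_ge1Dx (2 * L * t); lra.
have -> : picard x0 n.+2 t - picard x0 n.+1 t =
    \int[leb]_(s in `[0, t]) (V (picard x0 n.+1 s) - V (picard x0 n s)).
  have i1 := picard_int 0 t (picard_lip x0 n.+1).
  have i2 := picard_int 0 t (picard_lip x0 n).
  by rewrite RintegralB// /= /picard_step (max_r t0); ring.
set g := (fun s => V (picard x0 n.+1 s) - V (picard x0 n s)).
have mg : measurable_fun `[0, t] g.
  have /integrableP[/measurable_EFinP i1 _] := picard_int 0 t (picard_lip x0 n.+1).
  have /integrableP[/measurable_EFinP i2 _] := picard_int 0 t (picard_lip x0 n).
  exact: measurable_funB.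
pose K := M / (2 * L) * 2^-1 ^+ n * L.
have K0 : 0 <= K by rewrite /K !mulr_ge0 ?invr_ge0 ?exprn_ge0// ltW.
have gb s : s \in `[0, t] -> `|g s| <= K * expR (2 * L * s).
  rewrite in_itv/= => /andP[s0 st]; rewrite (le_trans (VL _ _))//.
  apply: (@le_trans _ _ (L * (M / (2 * L) * expR (2 * L * s) * 2^-1 ^+ n))).
    by rewrite ler_wpM2l ?IH// ltW.
  by rewrite /K le_eqVlt; apply/orP; left; apply/eqP; ring.
have cexp : continuous (fun s : R => expR (2 * L * s)).
  by move=> x; apply: continuous_comp; [exact: mulrl_continuous|exact: continuous_expR].
have iexp : leb.-integrable `[0, t] (EFin \o (fun s => expR (2 * L * s))).
  apply: continuous_compact_integrable; first exact: segment_compact.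
  exact: continuous_subspaceT.
have iKexp : leb.-integrable `[0, t] (EFin \o (fun s => K * expR (2 * L * s))).
  apply: continuous_compact_integrable; first exact: segment_compact.
  by apply: continuous_subspaceT => x; apply: cvgMr; exact: cexp.
have ig : leb.-integrable `[0, t] (EFin \o g).
  apply: le_integrable iKexp => //; first exact/measurable_EFinP.
  move=> s st /=; rewrite lee_fin (le_trans (gb _ st))// ler_norm//.
rewrite (le_trans (le_normr_Rintegral _ ig))//.
apply: (@le_trans _ _ (\int[leb]_(s in `[0, t]) (K * expR (2 * L * s)))).
  apply: le_Rintegral => //; first exact: integrable_norm.
rewrite RintegralZl// expR_integral// /K exprS.
rewrite (_ : _ * L * _ = M / (2 * L) * 2^-1 ^+ n * 2^-1 * (expR (2 * L * t) - 1)); last first.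
  by field; rewrite ?lt0r_neq0.
apply: (@le_trans _ _ (M / (2 * L) * 2^-1 ^+ n * 2^-1 * expR (2 * L * t))); last first.
  by rewrite le_eqVlt; apply/orP; left; apply/eqP; ring.
apply: ler_wpM2l; last lra.
by rewrite !mulr_ge0 ?invr_ge0 ?exprn_ge0// ltW.
Qed.

Lemma picard_cvg x0 t : 0 <= t -> cvgn (picard x0 ^~ t).
Proof.
move=> t0; pose u k := picard x0 k.+1 t - picard x0 k t.
suff cu : cvgn (series u).
  have -> : picard x0 ^~ t = (fun n => x0 + series u n).
    apply/funext => n; rewrite /series/= /u telescope_sumr//=.
    by rewrite addrC subrK.
  by apply: is_cvgD cu; exact: is_cvg_cst.
apply: normed_cvg.
apply: (@series_le_cvg _ _ (geometric (M / (2 * L) * expR (2 * L * t)) (2^-1))).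
- by move=> k; exact: normr_ge0.
- move=> k; rewrite /geometric/= !mulr_ge0 ?invr_ge0 ?expR_ge0 ?exprn_ge0//.
    exact: le_trans (VM 0).
  by rewrite mulr_ge0// ltW.
- by move=> k; rewrite /geometric/=; exact: picard_contract.
- by apply: is_cvg_geometric_series; rewrite ger0_norm ?invr_ge0// invf_lt1// ltr1n.
Qed.

(** The Picard iterates converge pointwise; the Euler estimate holds for each of
    them with the same constant, so it is kept in the limit. *)
Lemma ode_existence x0 : exists X : R -> R,
  [/\ X 0 = x0, euler_path V X (L * M)
    & forall t h, 0 <= t -> 0 <= h -> `|X (t + h) - X t| <= M * h].
Proof.
pose X (t : R) : R := limn (picard x0 ^~ t).
have cX t : 0 <= t -> picard x0 n t @[n --> \oo] --> X t by exact: picard_cvg.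
have cS t : 0 <= t -> picard x0 n.+1 t @[n --> \oo] --> X t.
  by move=> t0; have := cX t t0; rewrite -(cvg_shiftS (picard x0 ^~ t)).
exists X; split.
- have h0 n : picard x0 n 0 = x0.
    case: n => [|n] //=; rewrite /picard_step maxxx set_itv1 Rintegral_set1 addr0//.
  by rewrite /X (_ : picard x0 ^~ 0 = cst x0) ?lim_cst//; apply/funext.
- move=> t h t0 h0; have th0 : 0 <= t + h by exact: addr_ge0.
  have : `|picard x0 n.+1 (t + h) - picard x0 n.+1 t - h * V (picard x0 n t)|
      @[n --> \oo] --> `|X (t + h) - X t - h * V (X t)|.
    apply: cvg_norm; apply: cvgB; first by apply: cvgB; exact: cS.
    apply: cvgMr; have := @cV (X t).
    exact: (cvg_comp (fun n => picard x0 n t) V (cX t t0)).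
  move=> hc; apply: (@closed_cvg _ _ _ _ _ [set y | y <= L * M * h ^+ 2] _ _ _ hc).
    exact: closed_le.
  by apply: nearW => n; apply: picard_step_euler => //; exact: picard_lip.
- move=> t h t0 h0; have th0 : 0 <= t + h by exact: addr_ge0.
  have : `|picard x0 n (t + h) - picard x0 n t| @[n --> \oo] --> `|X (t + h) - X t|.
    by apply: cvg_norm; apply: cvgB; exact: cX.
  move=> hc; apply: (@closed_cvg _ _ _ _ _ [set y | y <= M * h] _ _ _ hc).
    exact: closed_le.
  apply: nearW => n /=; apply: (le_trans (picard_lip _ _ _ _)).
  by rewrite addrAC subrr add0r ger0_norm.
Qed.

End Picard.

(** * One-sided derivatives and uniqueness *)

Section DeriveWithin.
Context {R : realType}.
Implicit Types (A : set R) (g : R -> R).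

Lemma is_derive_withinP A g x l : is_derive_within A g x l <->
  forall e, 0 < e -> exists2 d, 0 < d & forall y, A y -> `|y - x| < d ->
    `|g y - g x - l * (y - x)| <= e * `|y - x|.
Proof.
split=> [/cvgrPdist_le h e e0|h].
  have := h _ e0; rewrite /within/= => /nbhs_ballP[d /= d0 hd].
  exists d => // y Ay yxd; have [->|yx] := eqVneq y x.
    by rewrite !subrr mulr0 subrr normr0 mulr0.
  have yx0 : y - x != 0 by rewrite subr_eq0.
  have := hd y; rewrite /ball/= distrC => /(_ yxd yx Ay).
  rewrite -(ler_pM2r (_ : 0 < `|y - x|)) ?normr_gt0//; apply: le_trans.
  by rewrite -normrM mulrBl divfK// -normrN opprB.
apply/cvgrPdist_le => e e0; have [d d0 hd] := h _ e0.
apply/nbhs_ballP; exists d => //= y; rewrite /ball/= distrC => yxd yx Ay.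
have yx0 : y - x != 0 by rewrite subr_eq0.
rewrite -(ler_pM2r (_ : 0 < `|y - x|)) ?normr_gt0// -normrM mulrBl divfK//.
by rewrite -normrN opprB; exact: hd.
Qed.

Lemma is_derive_within_continuous A g x l : is_derive_within A g x l ->
  forall e, 0 < e -> exists2 d, 0 < d & forall y, A y -> `|y - x| < d ->
    `|g y - g x| <= e.
Proof.
move=> /is_derive_withinP /(_ 1 ltr01)[d d0 hd] e e0.
have l1 : 0 < `|l| + 1 by rewrite ltr_wpDl.
exists (Num.min d (e / (`|l| + 1))); first by rewrite lt_min d0 divr_gt0.
move=> y Ay; rewrite lt_min => /andP[yd ye].
have := hd y Ay yd; rewrite mul1r => h.
rewrite (_ : g y - g x = g y - g x - l * (y - x) + l * (y - x)); last by ring.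
apply: (le_trans (ler_normD _ _)); rewrite normrM.
apply: (@le_trans _ _ ((`|l| + 1) * `|y - x|)).
  by rewrite mulrDl mul1r addrC lerD2l.
by rewrite mulrC -ler_pdivlMr// ltW.
Qed.

Lemma within_itv_continuous (a b : R) g :
  (forall x, x \in `[a, b] -> forall e, 0 < e -> exists2 d, 0 < d &
     forall y, y \in `[a, b] -> `|y - x| < d -> `|g y - g x| <= e) ->
  {within `[a, b], continuous g}.
Proof.
move=> h; apply/subspace_continuousP => x xab; apply/cvgrPdist_le => e e0.
have [d d0 hd] := h x xab e e0.
apply/nbhs_ballP; exists d => //= y; rewrite /ball/= distrC => yd yab.
by rewrite distrC; exact: hd.
Qed.

Lemma is_derive_interior (a b : R) g x l : is_derive_within `[a, b] g x l ->
  x \in `]a, b[ -> is_derive x 1 g l.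
Proof.
move=> /is_derive_withinP h; rewrite in_itv/= => /andP[ax xb].
suff cv : (fun t => t^-1 *: ((g \o shift x) (t *: 1) - g x)) @ 0^' --> l.
  by apply: DeriveDef; [apply/cvg_ex; exists l|exact/cvg_lim].
apply/cvgrPdist_le => e e0; have [d d0 hd] := h _ e0.
apply/nbhs_ballP; exists (Num.min d (Num.min (x - a) (b - x))) => /=.
  by rewrite !lt_min d0 !subr_gt0 ax.
move=> t; rewrite /ball/= sub0r normrN !lt_min => /and3P[td ta tb] t0.
rewrite /GRing.scale/= mulr1.
have E : t + x - x = t by ring.
have := hd (t + x); rewrite E => H.
have {}H : `|g (t + x) - g x - l * t| <= e * `|t|.
  apply: H => //=; rewrite in_itv/=; move: ta tb; rewrite !ltr_norml; lra.
rewrite -(ler_pM2r (_ : 0 < `|t|)) ?normr_gt0//; apply: le_trans H.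
rewrite -normrM (_ : (l - t^-1 * (g (t + x) - g x)) * t = - (g (t + x) - g x - l * t)) ?normrN//.
by field.
Qed.

Lemma mvt_within (a b : R) g dg :
  (forall x, x \in `[a, b] -> is_derive_within `[a, b] g x (dg x)) ->
  forall x y, x \in `[a, b] -> y \in `[a, b] -> x <= y ->
  exists2 z, z \in `[x, y] & g y - g x = dg z * (y - x).
Proof.
move=> h x y; rewrite !in_itv/= => /andP[ax xb] /andP[ay yb] xy.
apply: MVT_segment => //.
  move=> z; rewrite in_itv/= => /andP[xz zy]; apply: (@is_derive_interior a b).
    by apply: h; rewrite in_itv/=; lra.
  by rewrite in_itv/=; lra.
apply: within_itv_continuous => z; rewrite in_itv/= => /andP[xz zy] e e0.
have zab : z \in `[a, b] by rewrite in_itv/=; lra.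
have [d d0 hd] := is_derive_within_continuous (h z zab) e0.
by exists d => // w; rewrite in_itv/= => /andP[xw wy] wz; apply: hd => //=; rewrite in_itv/=; lra.
Qed.

Lemma mvt_within_dist (a b : R) g dg :
  (forall x, x \in `[a, b] -> is_derive_within `[a, b] g x (dg x)) ->
  forall x y, x \in `[a, b] -> y \in `[a, b] ->
  exists z, [/\ z \in `[a, b], `|z - x| <= `|y - x| & g y - g x = dg z * (y - x)].
Proof.
move=> h x y xab yab; have [xy|/ltW yx] := leP x y.
  have [z zxy E] := mvt_within h xab yab xy; exists z; split => //.
    by move: xab yab zxy; rewrite !in_itv/=; lra.
  by move: zxy; rewrite in_itv/= => zxy; rewrite !ger0_norm; lra.
have [z zxy E] := mvt_within h yab xab yx; exists z; split => //; last lra.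
  by move: xab yab zxy; rewrite !in_itv/=; lra.
by move: zxy; rewrite in_itv/= => zxy; rewrite !ler0_norm; lra.
Qed.

End DeriveWithin.

Section Uniqueness.
Context {R : realType}.
Variables (V : R -> R) (L : R).
Hypothesis VL : forall x y, `|V x - V y| <= L * `|x - y|.

(** The function (x - z)^2 exp(-2Ls) is nonincreasing. Taken with equal initial
    values this is uniqueness, with different ones the continuity of the flow. *)
Lemma ode_gronwall (x z : R -> R) (t : R) : 0 <= t ->
  (forall s, s \in `[0, t] -> is_derive_within `[0, t] x s (V (x s))) ->
  (forall s, s \in `[0, t] -> is_derive_within `[0, t] z s (V (z s))) ->
  `|x t - z t| <= expR (L * t) * `|x 0 - z 0|.
Proof.
move=> t0 hx hz.
pose u s : R := (x s - z s) ^+ 2 * expR (- (2 * L) * s).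
have oc s : s \in `]0, t[ -> s \in `[0, t] by apply: subset_itv_oo_cc.
have du s : s \in `]0, t[ -> is_derive s 1 u
    ((2 * ((x s - z s) * (V (x s) - V (z s))) - 2 * L * (x s - z s) ^+ 2) * expR (- (2 * L) * s)).
  move=> so; have dx := is_derive_interior (hx _ (oc _ so)) so.
  have dz := is_derive_interior (hz _ (oc _ so)) so.
  apply: is_derive_eq; rewrite /GRing.scale/= /GRing.scale/=; ring.
have ut : u t <= u 0.
  apply: (@ler0_derive1_le_cc _ u 0 t) => //; rewrite ?in_itv/= ?lexx ?t0//.
  - by move=> s so; have [] := du s so.
  - move=> s so; rewrite derive1E (@derive_val _ _ _ _ _ _ _ (du s so)).
    rewrite mulr_le0_ge0 ?expR_ge0// subr_le0 -mulrA ler_wpM2l//.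
    rewrite -real_normK ?num_real// expr2 mulrA (le_trans (ler_norm _))// normrM mulrC.
    by apply: ler_wpM2r => //; exact: VL.
  - have cw (w : R -> R) : (forall s, s \in `[0, t] -> is_derive_within `[0, t] w s (V (w s))) ->
      {within `[0, t], continuous w}.
      move=> hw; apply: within_itv_continuous => s st.
      exact: is_derive_within_continuous (hw s st).
    have cxz : {within `[0, t], continuous (fun s => x s - z s)}.
      by move=> s; apply: cvgB; [exact: cw hx s|exact: cw hz s].
    have ce : {within `[0, t], continuous (fun s => expR (- (2 * L) * s))}.
      apply: continuous_subspaceT => s; apply: continuous_comp; last exact: continuous_expR.
      exact: mulrl_continuous.
    by move=> s; apply: cvgM; [apply: cvgM; exact: cxz s|exact: ce s].
have e0 := expR_gt0 (L * t).
rewrite -(@ler_pXn2r _ 2)// ?nnegrE ?mulr_ge0 ?expR_ge0// exprMn !real_normK ?num_real//.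
have -> : expR (L * t) ^+ 2 = (expR (- (2 * L) * t))^-1.
  by rewrite -expRN expr2 -expRD; congr expR; ring.
move: ut; rewrite /u mulr0 expR0 mulr1 => ut.
by rewrite mulrC ler_pdivlMr ?expR_gt0.
Qed.

End Uniqueness.

Section EulerPath.
Context {R : realType}.
Variables (V X : R -> R) (L M C : R).
Hypothesis VL : forall x y, `|V x - V y| <= L * `|x - y|.
Hypothesis L0 : 0 <= L.
Hypothesis XE : euler_path V X C.
Hypothesis XM : forall t h, 0 <= t -> 0 <= h -> `|X (t + h) - X t| <= M * h.

Lemma euler_path_quad s y : 0 <= s -> 0 <= y ->
  `|X y - X s - V (X s) * (y - s)| <= (C + L * M) * (y - s) ^+ 2.
Proof.
move=> s0 y0; have M0 : 0 <= M.
  by have := XM (lexx 0) ler01; rewrite mulr1; exact: le_trans.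
have [sy|/ltW ys] := leP s y.
  have h0 : 0 <= y - s by rewrite subr_ge0.
  have := XE s0 h0; rewrite (_ : s + (y - s) = y); last by ring.
  rewrite mulrC => /le_trans; apply; apply: ler_wpM2r; first exact: sqr_ge0.
  by rewrite lerDl mulr_ge0.
have h0 : 0 <= s - y by rewrite subr_ge0.
have e1 : y + (s - y) = s by ring.
have := XE y0 h0; have := XM y0 h0; rewrite !e1 => m1 m2.
rewrite (_ : X y - X s - _ = - (X s - X y - (s - y) * V (X y)) +
   (s - y) * (V (X s) - V (X y))); last by ring.
apply: (le_trans (ler_normD _ _)); rewrite normrN [leRHS]mulrDl.
have -> : (y - s) ^+ 2 = (s - y) ^+ 2 by ring.
apply: lerD => //; rewrite normrM ger0_norm// expr2.
rewrite (_ : L * M * _ = (s - y) * (L * (M * (s - y)))); last by ring.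
apply: ler_wpM2l => //; apply: (le_trans (VL _ _)).
exact: ler_wpM2l.
Qed.

Lemma euler_path_derive t s : s \in `[0, t] ->
  is_derive_within `[0, t] X s (V (X s)).
Proof.
rewrite in_itv/= => /andP[s0 st]; apply/is_derive_withinP => e e0.
have K1 : 0 < `|C + L * M| + 1 by rewrite ltr_wpDl.
exists (e / (`|C + L * M| + 1)); first by rewrite divr_gt0.
move=> y; rewrite /= in_itv/= => /andP[y0 yt] ys.
apply: (le_trans (euler_path_quad s0 y0)).
rewrite -(real_normK (num_real (y - s))) expr2 mulrA; apply: ler_wpM2r => //.
apply: (@le_trans _ _ ((`|C + L * M| + 1) * `|y - s|)).
  by apply: ler_wpM2r => //; rewrite (le_trans (ler_norm _))// lerDl.
by rewrite mulrC -ler_pdivlMr// ltW.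
Qed.

Lemma euler_path_cont t e : 0 <= t -> 0 < e -> exists2 d, 0 < d &
  forall s, 0 <= s -> `|s - t| < d -> `|X s - X t| <= e.
Proof.
move=> t0 e0.
have t1 : t \in `[0, t + 1] by rewrite in_itv/=; lra.
have [d d0 hd] := is_derive_within_continuous (euler_path_derive t1) e0.
exists (Num.min d 1); first by rewrite lt_min d0 ltr01.
move=> s s0; rewrite lt_min => /andP[sd s1]; apply: hd => //=.
by rewrite in_itv/= s0; move: s1; rewrite ltr_norml; lra.
Qed.

(** A nonpositive frozen speed would never have let the path above [b]. With a
    nonnegative one the straight line started at [b] at time [tau] solves the
    equation, hence is the path. *)
Lemma euler_path_no_return b tau s1 : (forall y, b <= y -> V y = V b) ->
  0 <= tau -> X tau = b -> tau <= s1 -> b < X s1 ->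
  forall s, tau <= s -> b <= X s.
Proof.
move=> Vb tau0 Xtau taus1 bX1.
have [Vb0|Vb0] := leP 0 (V b).
  move=> s taus.
  have := @ode_gronwall _ V L VL (fun r => X (tau + r)) (fun r => b + V b * r) (s - tau).
  rewrite subr_ge0 taus => /(_ isT).
  rewrite addr0 Xtau mulr0 addr0 subrr normr0 mulr0 (_ : tau + (s - tau) = s); last by ring.
  move=> H; suff : `|X s - (b + V b * (s - tau))| <= 0.
    rewrite normr_le0 subr_eq0 => /eqP ->; rewrite lerDl mulr_ge0// subr_ge0//.
  apply: H => r; rewrite in_itv/= => /andP[r0 rs]; apply/is_derive_withinP => e e0.
    have tr : tau + r \in `[0, s] by rewrite in_itv/=; lra.
    have /is_derive_withinP/(_ _ e0)[d d0 hd] := euler_path_derive tr.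
    exists d => // y; rewrite /= in_itv/= => /andP[y0 ys] yr.
    have E : tau + y - (tau + r) = y - r by ring.
    have := hd (tau + y); rewrite E; apply => //=; rewrite in_itv/=; lra.
  exists 1 => // y _ _; rewrite Vb; last by rewrite lerDl mulr_ge0.
  rewrite (_ : b + V b * y - (b + V b * r) - V b * (y - r) = 0); last by ring.
  by rewrite normr0 mulr_ge0// ltW.
exfalso.
(* c is the last time before s1 at which the path is not above b *)
pose S := [set r | tau <= r <= s1 /\ X r <= b].
have S0 : S tau by rewrite /S/= lexx taus1 Xtau.
have hS : has_sup S by split; [exists tau|exists s1 => r [/andP[]]].
pose c := sup S.
have cS r : S r -> r <= c by move=> Sr; apply: ub_le_sup => //; case: hS.
have tauc : tau <= c by exact: cS.
have c0 : 0 <= c by exact: le_trans tauc.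
have cs1 : c <= s1 by apply: ge_sup; [exists tau|move=> r [/andP[]]].
have Xc : X c <= b.
  rewrite leNgt; apply/negP => bXc.
  have e0 : 0 < (X c - b) / 2 by rewrite divr_gt0// subr_gt0.
  have [d d0 hd] := euler_path_cont c0 e0.
  have [r Sr rc] := sup_adherent d0 hS.
  have rlec := cS _ Sr; case: Sr => /andP[taur rs1] Xr.
  have r0 : 0 <= r by exact: le_trans taur.
  have := hd r r0; rewrite -/c in rc.
  rewrite ltr_norml ler_norml => H; have : - d < r - c < d by lra.
  by move/H; lra.
have cs : c < s1.
  by rewrite lt_neqAle cs1 andbT; apply/eqP => e; move: bX1; rewrite -e ltNge Xc.
have dX r : r \in `[0, s1] -> is_derive_within `[0, s1] X r (V (X r)) by exact: euler_path_derive.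
have [r rc E] : exists2 r, r \in `]c, s1[ & X s1 - X c = V (X r) * (s1 - c).
  apply: MVT => //.
    move=> r; rewrite in_itv/= => /andP[cr rs].
    by apply: (@is_derive_interior _ 0 s1); [apply: dX|]; rewrite in_itv/=; lra.
  apply: within_itv_continuous => r; rewrite in_itv/= => /andP[cr rs] e e0.
  have r0 : 0 <= r by lra.
  have [d d0 hd] := euler_path_cont r0 e0; exists d => // y.
  by rewrite in_itv/= => /andP[cy ys]; apply: hd; lra.
move: rc; rewrite in_itv/= => /andP[cr rs].
have bXr : b <= X r.
  rewrite leNgt; apply/negP => Xrb.
  have : r <= c by apply: cS; split; [lra|exact: ltW].
  by rewrite leNgt cr.
rewrite Vb// in E.
have : V b * (s1 - c) <= 0 by rewrite mulr_le0_ge0 ?ltW// subr_gt0.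
by rewrite -E; lra.
Qed.

End EulerPath.

(** * The stopped flow *)

Section Clamp.
Context {R : realType}.
Implicit Types (x y : R).

Definition clamp01 x : R := Num.max 0 (Num.min x 1).

Lemma I01P x : I01 x <-> 0 <= x <= 1.
Proof. by rewrite /I01/= in_itv. Qed.

Lemma clamp01_in x : I01 (clamp01 x).
Proof.
apply/I01P; rewrite /clamp01 le_max lexx/= ge_max ler01/=.
by rewrite ge_min lexx orbT.
Qed.

Lemma clamp01_id x : I01 x -> clamp01 x = x.
Proof. by move=> /I01P/andP[x0 x1]; rewrite /clamp01 min_l// max_r. Qed.

Lemma clamp01_ge1 x : 1 <= x -> clamp01 x = 1.
Proof. by move=> x1; rewrite /clamp01 min_r// max_r. Qed.

Lemma clamp01_le0 x : x <= 0 -> clamp01 x = 0.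
Proof. by move=> x0; rewrite /clamp01 max_l// ge_min x0. Qed.

Lemma clamp01_dist x y : `|clamp01 x - clamp01 y| <= `|x - y|.
Proof.
wlog xy : x y / x <= y.
  by move=> h; have [/h//|/ltW/h] := leP x y; rewrite distrC (distrC y).
have : clamp01 y - clamp01 x <= y - x /\ clamp01 x <= clamp01 y.
  rewrite /clamp01; case: (leP x 1) => hx; case: (leP y 1) => hy;
    rewrite ?(max_r ler01);
    [case: (leP 0 x) => h0; case: (leP 0 y) => h1; lra
    |case: (leP 0 x) => h0; lra | lra | lra].
by move=> [h1 h2]; rewrite distrC (distrC x) !ger0_norm ?subr_ge0.
Qed.

End Clamp.

Lemma bounded_lipschitz_ex (R : realType) (A : set R) (g : R -> R) :
  bounded_lipschitz A g -> exists K, [/\ 0 < K, forall x, A x -> `|g x| <= K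
    & forall x y, A x -> A y -> `|g x - g y| <= K * `|x - y|].
Proof.
move=> [/pinfty_ex_gt0[M M0 hM] /pinfty_ex_gt0[L _ hL]].
exists (Num.max M L); split; first by rewrite lt_max M0.
- by move=> x Ax; rewrite le_max hM.
- move=> x y Ax Ay; apply: (le_trans (hL (x, y) _)) => //=.
  by apply: ler_wpM2r; rewrite // le_max lexx orbT.
Qed.

Section IsDeriveWithinSub.
Context {R : realType}.

Lemma is_derive_within_sub (A B : set R) g x l : B `<=` A ->
  is_derive_within A g x l -> is_derive_within B g x l.
Proof.
move=> BA /is_derive_withinP h; apply/is_derive_withinP => e /h[d d0 hd].
by exists d => // y /BA; exact: hd.
Qed.

End IsDeriveWithinSub.

Section StoppedPath.
Context {R : realType}.
Variables (v : R -> R) (K : R).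
Hypothesis K0 : 0 < K.
Hypothesis vK : forall x, I01 x -> `|v x| <= K.
Hypothesis vL : forall x y, I01 x -> I01 y -> `|v x - v y| <= K * `|x - y|.

(** A Lipschitz extension of [v] to the line, constant on each side of [0,1]. *)
Definition frozen_field (x : R) : R := v (clamp01 x).
Local Notation V := frozen_field.

Lemma frozen_field_bound x : `|V x| <= K.
Proof. by apply: vK; exact: clamp01_in. Qed.

Lemma frozen_field_lip x y : `|V x - V y| <= K * `|x - y|.
Proof.
apply: (le_trans (vL (clamp01_in x) (clamp01_in y))).
by apply: ler_wpM2l; [exact: ltW|exact: clamp01_dist].
Qed.

Lemma frozen_fieldE x : I01 x -> V x = v x.
Proof. by move=> Ix; rewrite /frozen_field clamp01_id. Qed.

Variables (x0 : R) (X : R -> R) (C : R).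
Hypothesis x0I : I01 x0.
Hypothesis X0 : X 0 = x0.
Hypothesis XE : euler_path V X C.
Hypothesis XM : forall t h, 0 <= t -> 0 <= h -> `|X (t + h) - X t| <= K * h.

Let VL := frozen_field_lip.
Let XD := euler_path_derive VL (ltW K0) XE XM.
Let XC := euler_path_cont VL (ltW K0) XE XM.

Lemma solution_eq t x : 0 <= t -> solution v x0 t x -> x t = X t.
Proof.
move=> t0 [x00 hx].
have := @ode_gronwall _ V K VL x X t t0.
rewrite x00 X0 subrr normr0 mulr0 normr_le0 subr_eq0 => H; apply/eqP; apply: H.
- by move=> s /hx[Ix]; rewrite frozen_fieldE.
- by move=> s; exact: XD.
Qed.

Lemma existence_intervalE t : 0 <= t ->
  existence_interval v x0 t <-> (forall s, s \in `[0, t] -> I01 (X s)).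
Proof.
move=> t0; split=> [[_ [x [x00 hx]]] s|h].
  rewrite in_itv/= => /andP[s0 st]; have st' : s \in `[0, t] by rewrite in_itv/= s0.
  have /hx[Ixs _] := st'.
  rewrite -(solution_eq (x := x) s0)//; split => // r; rewrite in_itv/= => /andP[r0 rs].
  have [|Ix D] := hx r; first by rewrite in_itv/= r0 (le_trans rs).
  split => //; apply: is_derive_within_sub D; apply: subset_itvl.
  by rewrite bnd_simp.
split => //; exists X; split => // s st; split; first exact: h.
by rewrite -frozen_fieldE; [exact: XD|exact: h].
Qed.

Lemma trajectoryE t : existence_interval v x0 t -> trajectory v x0 t = X t.
Proof.
move=> Et; have [t0 [x hx]] := Et.
have : [set y | exists2 x, solution v x0 t x & y = x t] (trajectory v x0 t).
  by apply: xgetPex; exists (x t); exists x.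
by move=> [x' hx' ->]; exact: solution_eq.
Qed.

(** At the exit time the path sits at an end of the interval and points of the
    path outside [0,1] accumulate at that time. From then on the path stays
    outside, so its projection is that end. *)
Lemma stopped_flowE t : 0 <= t -> stopped_flow v t x0 = clamp01 (X t).
Proof.
move=> t0; rewrite /stopped_flow; case: asboolP => Et.
  rewrite trajectoryE// clamp01_id//.
  by apply: (existence_intervalE t0).1 => //; rewrite in_itv/= t0 lexx.
pose E := existence_interval v x0.
have E0 : E 0.
  apply/existence_intervalE => // s; rewrite in_itv/= => /andP[s0 s0'].
  by rewrite (_ : s = 0) ?X0//; apply/eqP; rewrite eq_le s0 s0'.
have Et' s : E s -> s < t.
  move=> Es; have [s0 _] := Es; rewrite ltNge; apply/negP => ts; apply: Et.
  apply/existence_intervalE => // r; rewrite in_itv/= => /andP[r0 rt].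
  by apply: (existence_intervalE s0).1 => //; rewrite in_itv/= r0 (le_trans rt).
have hS : has_sup E by split; [exists 0|exists t => s /Et'/ltW].
pose tau := sup E.
have Etau s : E s -> s <= tau by move=> Es; apply: ub_le_sup => //; case: hS.
have tau0 : 0 <= tau by exact: Etau.
have Xin s : 0 <= s -> s < tau -> I01 (X s).
  move=> s0 st; have := sup_adherent (_ : 0 < tau - s) hS.
  rewrite subr_gt0 => /(_ st)[r Er]; rewrite -/tau subKr => sr.
  have r0 : 0 <= r by case: Er.
  by apply: (existence_intervalE r0).1 => //; rewrite in_itv/= s0 ltW.
have Xtau : I01 (X tau).
  apply/I01P; apply/negPn/negP => nI.
  have tau1 : 0 < tau.
    rewrite lt_neqAle tau0 andbT; apply/eqP => e; move: nI; rewrite -e X0.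
    by have /I01P -> := x0I.
  pose e := (Num.max (X tau - 1) (- X tau)) / 2.
  have e0 : 0 < e.
    by rewrite divr_gt0// lt_max; move: nI; rewrite negb_and -!ltNge => /orP[]; lra.
  have [d d0 hd] := XC tau0 e0.
  pose s := Num.max 0 (tau - d / 2).
  have s0 : 0 <= s by rewrite le_max lexx.
  have st : s < tau by rewrite gt_max tau1/=; lra.
  have sd : `|s - tau| < d.
    rewrite ltr_norml; apply/andP; split; last lra.
    have : tau - d / 2 <= s by rewrite le_max lexx orbT.
    lra.
  have := hd s s0 sd; rewrite ler_norml /e.
  have /I01P := Xin s s0 st.
  by case: (leP (X tau - 1) (- X tau)) e0; rewrite /e; case: leP; lra.
have XinC s : s \in `[0, tau] -> I01 (X s).
  rewrite in_itv/= => /andP[s0]; rewrite le_eqVlt => /predU1P[->//|].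
  exact: Xin.
have Ett : E tau by exact/existence_intervalE.
have -> : fine (exit_time v x0) = tau.
  rewrite /exit_time -[RHS]/(fine tau%:E); congr fine.
  apply/eqP; rewrite eq_le; apply/andP; split.
    by apply: ge_ereal_sup => _ [s Es <-]; rewrite lee_fin Etau.
  by apply: ereal_sup_ubound; exists tau.
rewrite trajectoryE//.
have taut : tau < t by exact: Et'.
have exit d : 0 < d -> exists s, [/\ tau < s, s < tau + d & ~ I01 (X s)].
  move=> d0; apply: contrapT => no.
  have : tau + d / 2 <= tau.
    apply: Etau; apply/existence_intervalE; first by rewrite addr_ge0// divr_ge0// ltW.
    move=> s; rewrite in_itv/= => /andP[s0 sd].
    have [st|ts] := leP s tau; first by apply: XinC; rewrite in_itv/= s0.
    by apply: contrapT => nI; apply: no; exists s; split => //; lra.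
  lra.
have near e : 0 < e -> exists s, [/\ tau < s, ~ I01 (X s) & `|X s - X tau| <= e].
  move=> e0; have [d d0 hd] := XC tau0 e0; have [s [ts sd nI]] := exit _ d0.
  by exists s; split => //; apply: hd; [lra|rewrite ltr_norml; lra].
move/I01P : (Xtau) => /andP[]; rewrite le_eqVlt => /predU1P[X0'|X0'].
  (* exit at 0: the reflected path exits at -0 through the top *)
  move=> _; have [s [ts /I01P nI]] := near (2^-1) ltac:(by rewrite invr_gt0).
  rewrite -X0' subr0 ler_norml => /andP[l1 l2].
  have Xs0 : X s < 0 by rewrite ltNge; apply/negP => h; apply: nI; lra.
  have := @euler_path_no_return _ (fun y => - V (- y)) (fun r => - X r) K K C.
  move=> /(_ _ _ _ _ 0 tau s)H.
  rewrite clamp01_le0// -oppr_ge0; apply: H => //.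
  - by move=> x y; rewrite -opprD normrN (le_trans (VL _ _))// -opprD normrN.
  - exact: ltW.
  - move=> r h r0 h0; rewrite opprK.
    rewrite (_ : - X (r + h) + X r - h * - V (X r) = - (X (r + h) - X r - h * V (X r)));
      last by ring.
    by rewrite normrN; exact: XE.
  - by move=> r h r0 h0; rewrite -opprD normrN; exact: XM.
  - by move=> y y0; rewrite /frozen_field !clamp01_le0// oppr_le0.
  - by rewrite -X0' oppr0.
  - exact: ltW.
  - by rewrite oppr_gt0.
  - exact: ltW.
rewrite le_eqVlt => /predU1P[X1|X1].
  have [s [ts /I01P nI]] := near (2^-1) ltac:(by rewrite invr_gt0).
  rewrite X1 ler_norml => /andP[l1 l2].
  have Xs1 : 1 < X s by rewrite ltNge; apply/negP => h; apply: nI; lra.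
  rewrite clamp01_ge1//; 
    apply: (euler_path_no_return VL (ltW K0) XE XM (tau := tau) (s1 := s)) => //;
    try exact: ltW.
  by move=> y y1; rewrite /frozen_field !clamp01_ge1.
pose e := Num.min (X tau) (1 - X tau) / 2.
have e0 : 0 < e by rewrite divr_gt0// lt_min X0' subr_gt0.
have [s [ts /I01P nI]] := near _ e0.
rewrite ler_norml => /andP[l1 l2]; exfalso; apply: nI.
have e1 : 2 * e <= X tau by rewrite /e mulrC divfK// ge_min lexx.
have e2 : 2 * e <= 1 - X tau by rewrite /e mulrC divfK// ge_min lexx orbT.
by clearbody e; lra.
Qed.

End StoppedPath.

Lemma stopped_flow_outside (R : realType) (v : R -> R) t x0 : ~ I01 x0 ->
  stopped_flow v t x0 = x0.
Proof.
move=> nI.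
have no s : 0 <= s -> forall x, ~ solution v x0 s x.
  move=> s0 x [x00 h]; apply: nI; rewrite -x00.
  by have [] := h 0; rewrite // in_itv/= lexx s0.
have noE s : ~ existence_interval v x0 s by move=> [s0 [x]]; exact: no.
rewrite /stopped_flow asboolF; last exact: noE.
have -> : exit_time v x0 = -oo%E.
  rewrite /exit_time (_ : existence_interval v x0 = set0) ?image_set0 ?ereal_sup0//.
  by apply/seteqP; split => // s /noE.
by apply: xgetPN => y [x hx _]; exact: (no (fine -oo) _ x hx).
Qed.

(** Here [Psi] is the flow of the frozen field followed by the projection onto
    [0,1]. In the last clause the Euler estimate fails only if the path has left
    [0,1] by time [t + h], hence is within one step of an end of the interval;
    there the derivative of a test function is small. *)
Lemma stopped_flow_regular (R : realType) (v : R -> R) : bounded_lipschitz I01 v ->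
  exists (Psi : R -> R -> R) (K : R), [/\ 0 < K, forall x, I01 x -> `|v x| <= K &
  [/\ forall t x, 0 <= t -> I01 x -> stopped_flow v t x = Psi t x,
      forall t x, I01 (Psi t x),
      forall t, 0 <= t -> continuous (Psi t),
      forall x, I01 x -> Psi 0 x = x
    & forall t h x, 0 <= t -> 0 <= h -> I01 x ->
      `|Psi (t + h) x - Psi t x| <= K * h /\
      ((exists2 b, b = 0 \/ b = 1 & `|Psi t x - b| <= K * h) \/
       `|Psi (t + h) x - Psi t x - h * v (Psi t x)| <= K * h ^+ 2)]].
Proof.
move=> /bounded_lipschitz_ex[K [K0 vK vL]].
have VL := frozen_field_lip K0 vL; have VM := frozen_field_bound vK.
have [X XP] := choice (ode_existence K0 VL VM).
have K2 : K <= Num.max K (K * K) by rewrite le_max lexx.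
exists (fun t x => clamp01 (X (clamp01 x) t)), (Num.max K (K * K)).
split; first by rewrite lt_max K0.
  by move=> x Ix; rewrite le_max vK.
split.
- move=> t x t0 Ix; have [h1 h2 h3] := XP x.
  by rewrite (clamp01_id Ix); exact: (stopped_flowE K0 vL Ix h1 h2 h3 t0).
- by move=> t x; exact: clamp01_in.
- move=> t t0; apply: (@lipschitz_continuous _ _ (expR (K * t))) => x y.
  apply: (le_trans (clamp01_dist _ _)).
  have [x1 x2 x3] := XP (clamp01 x); have [y1 y2 y3] := XP (clamp01 y).
  apply: (@le_trans _ _ (expR (K * t) * `|clamp01 x - clamp01 y|)).
    rewrite -{2}x1 -{2}y1; apply: (ode_gronwall VL) => // s st.
      exact: (euler_path_derive VL (ltW K0) x2 x3).
    exact: (euler_path_derive VL (ltW K0) y2 y3).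
  by apply: ler_wpM2l; [exact: expR_ge0|exact: clamp01_dist].
- by move=> x Ix; have [h1 _ _] := XP (clamp01 x); rewrite h1 !clamp01_id//; exact: clamp01_in.
- move=> t h x t0 h0 Ix; rewrite (clamp01_id Ix); have [h1 h2 h3] := XP x.
  split.
    apply: (le_trans (clamp01_dist _ _)); apply: (le_trans (h3 _ _ t0 h0)).
    exact: ler_wpM2r.
  have nb (y z : R) : ~ I01 z -> exists2 b, b = 0 \/ b = 1 & `|clamp01 y - b| <= `|y - z|.
    move=> /I01P nz; have [z0|z0] := ltP z 0.
      exists 0; [by left|]; rewrite -(clamp01_le0 (ltW z0)); exact: clamp01_dist.
    exists 1; [by right|]; rewrite -(@clamp01_ge1 _ z); first exact: clamp01_dist.
    by rewrite leNgt; apply/negP => z1; apply: nz; rewrite z0 ltW.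
  have [I1|nI] := pselect (I01 (X x t)); last first.
    left; have [b bb hb] := nb (X x t) _ nI; exists b => //.
    by apply: (le_trans hb); rewrite subrr normr0 mulr_ge0// (le_trans _ K2)// ltW.
  have [I2|nI] := pselect (I01 (X x (t + h))); last first.
    left; have [b bb hb] := nb (X x t) _ nI; exists b => //.
    apply: (le_trans hb); rewrite distrC; apply: (le_trans (h3 _ _ t0 h0)).
    exact: ler_wpM2r.
  right; rewrite !clamp01_id// -(frozen_fieldE v I1).
  apply: (le_trans (h2 _ _ t0 h0)); apply: ler_wpM2r; first exact: sqr_ge0.
  by rewrite le_max lexx orbT.
Qed.

(** * Approximation by continuous and by Lipschitz functions *)

Section EpsDelta.
Context {R : realType}.
Implicit Types (g : R -> R) (A : set R).

Lemma continuousP_dist g : continuous g <->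
  forall x e, 0 < e -> exists2 d, 0 < d & forall y, `|y - x| < d -> `|g y - g x| <= e.
Proof.
split=> [cg x e e0|h x].
  have /cvgrPdist_le/(_ _ e0)/nbhs_ballP[d /= d0 hd] := cg x.
  by exists d => // y; rewrite distrC => xy; rewrite distrC; exact: hd.
apply/cvgrPdist_le => e e0; have [d d0 hd] := h x e e0.
by apply/nbhs_ballP; exists d => //= y; rewrite /ball/= distrC => xy; rewrite distrC; exact: hd.
Qed.

Lemma continuous_clamp g :
  (forall x e, I01 x -> 0 < e -> exists2 d, 0 < d & forall y, I01 y -> `|y - x| < d ->
     `|g y - g x| <= e) ->
  continuous (fun x => g (clamp01 x)).
Proof.
move=> h; apply/continuousP_dist => x e e0.
have [d d0 hd] := h _ _ (clamp01_in x) e0; exists d => // y yx.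
apply: hd; first exact: clamp01_in.
exact: le_lt_trans (clamp01_dist _ _) yx.
Qed.

(** Heine's theorem. *)
Lemma rect_unif_continuous (a b c d : R) (g : R -> R -> R) :
  {within `[a, b]%classic `*` `[c, d]%classic, continuous (fun p : R * R => g p.1 p.2)} ->
  forall e, 0 < e -> exists2 r, 0 < r & forall x y s t,
    x \in `[a, b] -> y \in `[a, b] -> s \in `[c, d] -> t \in `[c, d] ->
    `|y - x| < r -> `|t - s| < r -> `|g y t - g x s| <= e.
Proof.
set Q := _ `*` _ => cg e e0.
have cQ : compact Q by apply: compact_setX; exact: segment_compact.
pose P (r : R) (p : R * R) := forall q, Q q -> `|q.1 - p.1| < r -> `|q.2 - p.2| < r ->
  `|g q.1 q.2 - g p.1 p.2| <= e.
have := (near_covering_withinP Q).2 ((compact_near_coveringP Q).1 cQ) R (0^'+) P _.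
have H : forall p, Q p -> \forall p' \near p & r \near 0^'+, Q p' -> P r p'.
  move=> p Qp; have e2 : 0 < e / 2 by rewrite divr_gt0.
  have /subspace_continuousP/(_ p Qp)/cvgrPdist_le/(_ _ e2) := cg.
  rewrite /within/= => /nbhs_ballP[r /= r0 hr].
  exists (ball p (r / 2), [set t | t < r / 2]).
    split; first by apply: nbhsx_ballx; rewrite divr_gt0.
    by apply: nbhs_right_lt; rewrite divr_gt0.
  move=> [p' t] /= [[b1 b2] tr] Qp' q Qq q1 q2.
  have hp' : `|g p.1 p.2 - g p'.1 p'.2| <= e / 2.
    apply: hr => //; split; apply: (@le_ball _ _ _ (r / 2)) => //; lra.
  have hq : `|g p.1 p.2 - g q.1 q.2| <= e / 2.
    apply: hr => //.
    move: b1 b2; rewrite /ball/= /ball/= => b1 b2; split; rewrite /ball/=.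
      rewrite (_ : p.1 - q.1 = (p.1 - p'.1) - (q.1 - p'.1)); last by ring.
      by apply: (le_lt_trans (ler_normB _ _)); lra.
    rewrite (_ : p.2 - q.2 = (p.2 - p'.2) - (q.2 - p'.2)); last by ring.
    by apply: (le_lt_trans (ler_normB _ _)); lra.
  rewrite (_ : _ - _ = (g p.1 p.2 - g p'.1 p'.2) - (g p.1 p.2 - g q.1 q.2)); last by ring.
  by apply: (le_trans (ler_normB _ _)); lra.
move=> /(_ _ H) {}H.
have [r [r0 hr]] : exists r : R, 0 < r /\ Q `<=` P r.
  near (0 : R)^'+ => r; exists r; split; first by near: r; exact: nbhs_right_gt.
  by near: r; exact: H.
exists r => // x y s t xab yab scd tcd yx ts.
exact: (hr (x, s) _ (y, t)).
Unshelve. all: by end_near. Qed.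

Lemma cts_unif_I01 g : continuous g -> forall e, 0 < e -> exists2 r, 0 < r &
  forall x y, I01 x -> I01 y -> `|y - x| < r -> `|g y - g x| <= e.
Proof.
move=> cg e e0.
have [|r r0 hr] := @rect_unif_continuous 0 1 0 1 (fun x _ => g x) _ e e0.
  by apply: continuous_subspaceT => p; apply: continuous_comp; [exact: cvg_fst|exact: cg].
exists r => // x y Ix Iy yx; apply: (hr x y 0 0) => //; rewrite ?in_itv/= ?lexx ?ler01//.
by rewrite subrr normr0.
Qed.

Lemma cts_bounded_I01 g : continuous g -> exists2 B, 0 <= B & forall x, I01 x -> `|g x| <= B.
Proof.
move=> /bdd_meas01_cts[_ [B hB]]; exists B => //.
have I0 : I01 (0 : R) by apply/I01P; rewrite lexx ler01.
exact: le_trans (hB _ I0).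
Qed.

(** The inf-convolutions [x |-> inf_y (phi y + k |x - y|)] are Lipschitz and
    converge uniformly to [phi]. *)
Lemma lipschitz_approx phi : continuous phi -> forall e, 0 < e ->
  exists (g : R -> R) (k : R), (forall x y, `|g x - g y| <= k * `|x - y|) /\
    forall x, I01 x -> `|g x - phi x| <= e.
Proof.
move=> cphi e e0.
have [B B0 hB] := cts_bounded_I01 cphi.
have [d d0 hd] := cts_unif_I01 cphi e0.
(* beyond distance d the penalty k |x - y| exceeds the oscillation of phi *)
pose k := 2 * B / d.
have k0 : 0 <= k by rewrite /k divr_ge0 ?mulr_ge0// ltW.
pose S x := [set phi y + k * `|x - y| | y in I01].
have I0 : I01 (0 : R) by apply/I01P; rewrite lexx ler01.
have S0 x : S x !=set0 by exists (phi 0 + k * `|x - 0|); exists 0.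
have lbS x : lbound (S x) (- B).
  move=> _ [y Iy <-]; have := hB y Iy; rewrite ler_norml => /andP[h1 _].
  by rewrite (le_trans h1)// lerDl mulr_ge0.
have hS x : has_inf (S x) by split => //; exists (- B).
pose g x := inf (S x).
have gle x y : I01 y -> g x <= phi y + k * `|x - y|.
  by move=> Iy; apply: ge_inf; [by exists (- B)|exists y].
have gge x c : (forall y, I01 y -> c <= phi y + k * `|x - y|) -> c <= g x.
  by move=> h; apply: lb_le_inf => // _ [y Iy <-]; exact: h.
exists g, k; split.
  have one x y : g x - k * `|x - y| <= g y.
    apply: gge => z Iz; rewrite lerBlDr (le_trans (gle x z Iz))// -addrA lerD2l.
    by rewrite -mulrDr ler_wpM2l// (addrC `|y - z|) ler_distD.
  move=> x y; rewrite ler_norml; have := one x y; have := one y x.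
  rewrite (distrC y); lra.
move=> x Ix; rewrite ler_norml; apply/andP; split; last first.
  by have := gle x x Ix; rewrite subrr normr0 mulr0 addr0; lra.
rewrite lerBrDr addrC; apply: gge => y Iy.
have [yx|yx] := ltP `|y - x| d.
  have := hd x y Ix Iy yx; rewrite ler_norml => /andP[h1 _].
  have kp : 0 <= k * `|x - y| by rewrite mulr_ge0.
  lra.
have := hB x Ix; have := hB y Iy; rewrite !ler_norml => /andP[h1 h2] /andP[h3 h4].
have : 2 * B <= k * `|x - y|.
  by rewrite distrC /k -mulrA ler_peMr ?mulr_ge0// mulrC ler_pdivlMr// mul1r.
lra.
Qed.

End EpsDelta.

Section PiecewiseApprox.
Context {R : realType}.
Implicit Types (f : R -> R).

Lemma cvg_bigsum (T I : Type) (F : set_system T) (s : seq I) (g : I -> T -> R) (l : I -> R) :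
  Filter F -> (forall i, g i x @[x --> F] --> l i) ->
  \sum_(i <- s) g i x @[x --> F] --> \sum_(i <- s) l i.
Proof.
move=> FF h; apply: (cvg_big (op := +%R)) => // p.
exact: add_continuous.
Qed.

Lemma subdivision_cover (a : nat -> R) (k : nat) x : a 0%N <= x <= a k ->
  exists2 i, (i <= k)%N & x = a i \/ (i < k)%N /\ a i < x < a i.+1.
Proof.
elim: k => [|k IH] /andP[x0 xk].
  by exists 0%N => //; left; apply/eqP; rewrite eq_le x0 xk.
have [xak|akx] := leP x (a k).
  have [|i ik [->|[ik' h]]] := IH; first by rewrite x0.
    by exists i; [exact: ltnW|left].
  by exists i; [exact: ltnW|right; split => //; exact: ltnW].
move: xk; rewrite le_eqVlt => /predU1P[->|xk]; first by exists k.+1 => //; left.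
by exists k => //; right; rewrite akx xk.
Qed.

(** A point of [0,1] off the subdivision lies in an open piece, where [f] is
    Lipschitz; finitely many pieces and end points have a common bound. *)
Lemma piecewise_regular f : piecewise_bounded_lipschitz f ->
  exists (Z : seq R) (K : R), (forall x, I01 x -> `|f x| <= K) /\
    (forall x, I01 x -> x \notin Z -> forall e, 0 < e -> exists2 d, 0 < d &
       forall y, `|y - x| < d -> `|f y - f x| <= e).
Proof.
move=> [n [a [a0 an _ fa]]].
have cov x : I01 x -> exists2 i, (i <= n)%N & x = a i \/ (i < n)%N /\ a i < x < a i.+1.
  by move=> /I01P; rewrite -a0 -an; exact: subdivision_cover.
exists [seq a i | i <- iota 0 n.+1].
have bnd m : (m <= n.+1)%N -> exists K, forall i x, (i < m)%N ->
    x = a i \/ (i < n)%N /\ a i < x < a i.+1 -> `|f x| <= K.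
  elim: m => [|m IH] mn; first by exists 0.
  have [K hK] := IH (ltnW mn).
  have [K' hK'] : exists K', (m < n)%N -> forall x, a m < x < a m.+1 -> `|f x| <= K'.
    have [mn'|_] := ltnP m n; last by exists 0.
    have [K' [_ hK' _]] := bounded_lipschitz_ex (fa m mn').
    by exists K' => _ x h; apply: hK'; rewrite /= in_itv.
  exists (Num.max K (Num.max K' `|f (a m)|)) => i x.
  rewrite ltnS leq_eqVlt => /predU1P[->|im] h; last by rewrite le_max (hK i).
  case: h => [->|[h1 h2]]; first by rewrite !le_max lexx !orbT.
  by rewrite !le_max hK' ?orbT.
have [K hK] := bnd n.+1 (leqnn _).
exists K; split; first by move=> x /cov[i ik h]; apply: (hK i).
move=> x /cov[i ik [->|[ik' h]]].
  by move=> /negP[]; apply: map_f; rewrite mem_iota.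
move=> _ e e0; have [L [L0 _ hL]] := bounded_lipschitz_ex (fa i ik').
move: h => /andP[h1 h2].
exists (Num.min (e / L) (Num.min (x - a i) (a i.+1 - x))).
  by rewrite !lt_min divr_gt0// !subr_gt0 h1.
move=> y; rewrite !lt_min => /and3P[ye ya yb].
apply: (le_trans (hL y x _ _)).
- by rewrite /= in_itv/=; move: ya yb; rewrite !ltr_norml; lra.
- by rewrite /= in_itv/= h1.
- by rewrite mulrC -ler_pdivlMr// ltW.
Qed.

Definition ramp (n : nat) (u : R) : R := Num.min 1 (n%:R * u).

Lemma ramp01 n u : 0 <= u -> 0 <= ramp n u <= 1.
Proof. by move=> u0; rewrite /ramp le_min ler01 mulr_ge0//= ge_min lexx. Qed.

Lemma ramp0 n : ramp n 0 = 0.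
Proof. by rewrite /ramp mulr0 min_r. Qed.

Lemma ramp_cvg u : 0 <= u -> ramp n u @[n --> \oo] --> ((u != 0)%:R : R).
Proof.
rewrite le_eqVlt => /predU1P[<-|u0].
  by rewrite eqxx/=; apply: cvg_near_cst; apply: nearW => n; rewrite ramp0.
rewrite gt_eqF//=; apply: cvg_near_cst.
have := nbhs_infty_ger (u^-1); apply: filterS => n un.
by rewrite /ramp min_l// -ler_pdivrMr// div1r.
Qed.

Lemma ramp_cts n (g : R -> R) : continuous g -> continuous (fun x => ramp n (g x)).
Proof.
move=> cg x; rewrite /ramp.
apply: (@continuous_min R R (cst 1) (fun x => n%:R * g x)); first exact: cst_continuous.
by apply: cvgMr; exact: cg.
Qed.

(** Multiplying [f] by a ramp that vanishes on the bad set [Z], and is 1 away from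
    it, makes [f] continuous; spikes at the points of [Z] restore its values
    there. *)
Lemma piecewise_approx f : piecewise_bounded_lipschitz f ->
  exists (f_ : nat -> R -> R) (K : R),
  [/\ forall n, continuous (f_ n), forall n x, I01 x -> `|f_ n x| <= K
    & forall x, I01 x -> f_ n x @[n --> \oo] --> f x].
Proof.
move=> /piecewise_regular[Z [K [fK fc]]].
have K0 : 0 <= K.
  have I0 : I01 (0 : R) by apply/I01P; rewrite lexx ler01.
  exact: le_trans (fK _ I0).
pose D x := \prod_(z <- Z) `|x - z|.
have D0 x : 0 <= D x by rewrite /D prodr_ge0.
have cD : continuous D.
  rewrite /D; elim: {fc D0 D} Z => [|z Z IH].
    by under eq_fun do rewrite big_nil; exact: cst_continuous.
  under eq_fun do rewrite big_cons.
  move=> x; apply: cvgM; last exact: IH.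
  by apply: cvg_norm; apply: cvgB; [exact: cvg_id|exact: cvg_cst].
have DZ x : (D x == 0) = (x \in Z).
  rewrite /D; elim: {fc D0 cD D} Z => [|z Z IH]; first by rewrite big_nil oner_eq0.
  by rewrite big_cons mulf_eq0 IH normr_eq0 subr_eq0 in_cons.
pose h n x := f x * ramp n (D x) + \sum_(z <- undup Z) f z * (1 - ramp n `|x - z|).
exists (fun n x => h n (clamp01 x)), (K + \sum_(z <- undup Z) `|f z|); split.
- move=> n; have ck : continuous (fun x => f (clamp01 x) * ramp n (D (clamp01 x))).
    apply: (@continuous_clamp R (fun x => f x * ramp n (D x))) => x e Ix e0.
    have K1 : 0 < K + 1 by rewrite ltr_wpDl.
    have e1 : 0 < e / 2 / (K + 1) by rewrite !divr_gt0.
    have /continuousP_dist/(_ x _ e1)[d d0 hd] := ramp_cts (n := n) cD.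
    have fe y : I01 y -> `|y - x| < d ->
        `|f y| * `|ramp n (D y) - ramp n (D x)| <= e / 2.
      move=> Iy /hd H; apply: (@le_trans _ _ ((K + 1) * (e / 2 / (K + 1)))).
        by apply: ler_pM => //; rewrite (le_trans (fK _ Iy))// lerDl.
      by rewrite mulrC divfK// gt_eqF.
    have [xZ|xZ] := boolP (x \in Z).
      have D0' : D x = 0 by apply/eqP; rewrite DZ.
      exists d => // y Iy yx; have := fe y Iy yx.
      by rewrite D0' ramp0 mulr0 !subr0 normrM; lra.
    have e2 : 0 < e / 2 by rewrite divr_gt0.
    have [d' d'0 hd'] := fc x Ix xZ _ e2.
    exists (Num.min d d'); first by rewrite lt_min d0.
    move=> y Iy; rewrite lt_min => /andP[yd yd'].
    rewrite (_ : _ - _ = f y * (ramp n (D y) - ramp n (D x)) + (f y - f x) * ramp n (D x));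
      last by ring.
    apply: (le_trans (ler_normD _ _)); rewrite !normrM.
    have := fe y Iy yd; have := hd' y yd'.
    have /andP[r0 r1] := ramp01 n (D0 x); rewrite (ger0_norm r0).
    have : `|f y - f x| * ramp n (D x) <= `|f y - f x| by rewrite ler_piMr.
    lra.
  have cs z : continuous (fun x => f z * (1 - ramp n `|clamp01 x - z|)).
    have cn : continuous (fun x => `|clamp01 x - z|).
      move=> y; apply: cvg_norm; apply: cvgB; last exact: cvg_cst.
      apply: (lipschitz_continuous (k := 1)) => p q.
      by rewrite mul1r; exact: clamp01_dist.
    by move=> y; apply: cvgMr; apply: cvgB; [exact: cvg_cst|exact: (ramp_cts cn)].
  move=> x; rewrite /h; apply: cvgD; first exact: ck.
  by apply: cvg_bigsum => z; exact: cs.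
- move=> n x Ix; rewrite clamp01_id// /h; apply: (le_trans (ler_normD _ _)).
  apply: lerD.
    have /andP[r0 r1] := ramp01 n (D0 x).
    by rewrite normrM (ger0_norm r0) -[K]mulr1 ler_pM// fK.
  apply: (le_trans (ler_norm_sum _ _ _)); apply: ler_sum => z _.
  have /andP[r0 r1] := ramp01 n (normr_ge0 (x - z)).
  by rewrite normrM ler_piMr// ger0_norm; lra.
- move=> x Ix; rewrite clamp01_id// /h.
  have E : f x = f x * ((D x != 0)%:R) +
      \sum_(z <- undup Z) f z * (1 - (`|x - z| != 0)%:R).
    rewrite DZ; case: (boolP (x \in Z)) => xZ; rewrite ?mulr0 ?mulr1 ?add0r.
      rewrite (bigD1_seq x) ?mem_undup ?undup_uniq//= subrr normr0 eqxx subr0 mulr1.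
      rewrite big1 ?addr0// => z zx.
      by rewrite normr_eq0 subr_eq0 eq_sym zx subrr mulr0.
    rewrite big1_seq ?addr0// => z /andP[_]; rewrite mem_undup => zZ.
    rewrite normr_eq0 subr_eq0 (_ : x != z) ?subrr ?mulr0//.
    by apply/eqP => e; move: xZ; rewrite e zZ.
  rewrite [X in _ --> X]E.
  apply: cvgD; first by apply: cvgMr; exact: ramp_cvg.
  apply: cvg_bigsum => z; apply: cvgMr; apply: cvgB; first exact: cvg_cst.
  exact: ramp_cvg.
Qed.

End PiecewiseApprox.

(** * Weakly continuous families of signed measures *)

Lemma BL_norm_le (R : realType) (phi : R -> R) (B k : R) :
  (forall x, I01 x -> `|phi x| <= B) ->
  (forall x y, I01 x -> I01 y -> `|phi x - phi y| <= k * `|x - y|) ->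
  (BL_norm phi <= (B + k)%:E)%E.
Proof.
move=> hB hk; rewrite /BL_norm EFinD; apply: leeD.
  by apply: ge_ereal_sup => _ [x Ix <-]; rewrite lee_fin hB.
by apply: ereal_inf_lbound; exists k => // -[x y] /= [Ix Iy]; exact: hk.
Qed.

Lemma lipschitz_scale_BL (R : realType) (phi : R -> R) (k : R) : continuous phi ->
  (forall x y, `|phi x - phi y| <= k * `|x - y|) ->
  exists2 c, 0 < c & (BL_norm (fun x => c * phi x)%R <= 1)%E.
Proof.
move=> cphi hk; have [B B0 hB] := cts_bounded_I01 cphi.
have k0 : 0 <= k by have := hk 0 1; rewrite sub0r normrN1 mulr1; exact/le_trans.
pose c := (B + k + 1)^-1.
have c0 : 0 < c by rewrite invr_gt0; lra.
exists c => //; apply: (le_trans (@BL_norm_le _ _ (c * B) (c * k) _ _)).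
- by move=> x Ix; rewrite normrM (gtr0_norm c0) ler_wpM2l ?hB// ltW.
- move=> x y _ _; rewrite -mulrBr normrM (gtr0_norm c0) -mulrA.
  by rewrite ler_wpM2l ?hk// ltW.
- by rewrite lee_fin -mulrDr mulrC ler_pdivrMr; lra.
Qed.

Lemma BL_dual_norm_ge (R : realType) (F : (R -> R) -> R) phi :
  (BL_norm phi <= 1)%E -> (`|F phi|%:E <= BL_dual_norm F)%E.
Proof. by move=> h; apply: ereal_sup_ubound; exists phi. Qed.

Lemma nbhs0_lt (R : realType) (e : R) : 0 < e -> nbhs (0%E : \bar R) [set x | (x < e%:E)%E].
Proof.
move=> e0; apply: open_nbhs_nbhs; split; first exact: open_ereal_lt_ereal.
by rewrite /= lte_fin.
Qed.

Lemma bdd_meas01_cvg (R : realType) (phi_ : nat -> R -> R) phi (M : R) :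
  (forall n, measurable_fun I01 (phi_ n)) ->
  (forall n x, I01 x -> `|phi_ n x| <= M) ->
  (forall x, I01 x -> phi_ ^~ x @ \oo --> phi x) -> bdd_meas01 phi.
Proof. by move=> h1 h2 h3; have [] := Rintegral_bounded_cvg (@mzero _ _ R) h1 h2 h3. Qed.

Section Curves.
Context {R : realType}.
Variables (mu : R -> {charge set R -> \bar R}) (T C : R).
Hypothesis muTV : forall t, t \in `[0, T] -> (TV_norm (mu t) <= C%:E)%E.
Hypothesis muC : forall t, t \in `[0, T] ->
  BL_dual_norm (pairing (mu s) \- pairing (mu t))
    @[s --> within `[0, T]%classic (nbhs t)] --> 0%E.
Local Notation dP t := (daniell_pairing (mu t)).

Lemma pairing_TV t phi (M : R) : t \in `[0, T] -> continuous phi ->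
  (forall x, I01 x -> `|phi x| <= M) -> `|pairing (mu t) phi| <= C * M.
Proof.
move=> tT cphi hM; have bphi := bdd_meas01_cts cphi.
have I0 : I01 (0 : R) by apply/I01P; rewrite lexx ler01.
have : 0 <= M by exact: le_trans (hM _ I0).
rewrite le_eqVlt => /predU1P[M0|M0].
  rewrite (@daniell_eq _ _ (dP t) _ (fun=> 0)); last first.
    by move=> x; rewrite inE => /hM; rewrite -M0 normr_le0 => /eqP.
  by rewrite (daniell0 (dP t)) -M0 mulr0 normr0.
have one (a : R) : `|a| = 1 -> a * pairing (mu t) phi <= C * M.
  move=> a1; rewrite -ler_pdivrMr// -lee_fin; apply: le_trans (muTV tT).
  apply: ereal_sup_ubound; exists (fun x => (a / M) * phi x).
    split; first by apply: continuous_subspaceT => x; apply: cvgMr; exact: cphi.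
    move=> x Ix; rewrite !normrM a1 mul1r normfV (gtr0_norm M0) mulrC.
    by rewrite ler_pdivrMr// mul1r hM.
  by rewrite (daniellZ (dP t))// mulrAC.
rewrite ler_norml; have := one 1 (normr1 _); have := one (-1); rewrite normrN1 => /(_ erefl).
by rewrite mulN1r mul1r; lra.
Qed.

(** The dual norm controls Lipschitz test functions; continuous ones are uniform
    limits of those, and the bound on the total variation makes the error
    uniform in time. *)
Lemma pairing_continuous t phi e : t \in `[0, T] -> continuous phi -> 0 < e ->
  exists2 d, 0 < d & forall s, s \in `[0, T] -> `|s - t| < d ->
    `|pairing (mu s) phi - pairing (mu t) phi| <= e.
Proof.
have lipcase psi k e' : t \in `[0, T] -> continuous psi -> 0 < e' ->
   (forall x y, `|psi x - psi y| <= k * `|x - y|) ->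
   exists2 d, 0 < d & forall s, s \in `[0, T] -> `|s - t| < d ->
    `|pairing (mu s) psi - pairing (mu t) psi| <= e'.
  move=> tT cpsi e0 hk; have bpsi := bdd_meas01_cts cpsi.
  have [c c0 bl] := lipschitz_scale_BL cpsi hk.
  have /(_ _ (nbhs0_lt (_ : 0 < c * e'))) := muC tT.
  rewrite mulr_gt0// => /(_ isT); rewrite /within/= => /nbhs_ballP[d /= d0 hd].
  exists d => // s sT st; have := hd s; rewrite /ball/= distrC => /(_ st sT)/ltW.
  move=> /(le_trans (BL_dual_norm_ge _ bl)).
  rewrite lee_fin /= (daniellZ (dP s))// (daniellZ (dP t))// -mulrBr normrM.
  by rewrite (gtr0_norm c0) ler_pM2l.
move=> tT cphi e0; have C1 : 0 < `|C| + 1 by rewrite ltr_wpDl.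
have a0 : 0 < e / (3 * (`|C| + 1)) by rewrite divr_gt0// mulr_gt0.
have [g [k [gk gphi]]] := lipschitz_approx cphi a0.
have cg : continuous g by exact: lipschitz_continuous gk.
have e3 : 0 < e / 3 by rewrite divr_gt0.
have [d d0 hd] := lipcase g k (e / 3) tT cg e3 gk.
have near s : s \in `[0, T] -> `|pairing (mu s) g - pairing (mu s) phi| <= e / 3.
  move=> sT; rewrite -(daniell_sub (dP s)); try exact: bdd_meas01_cts.
  have cgp : continuous (fun x => g x - phi x).
    by move=> x; apply: cvgB; [exact: cg|exact: cphi].
  apply: (le_trans (pairing_TV sT cgp gphi)).
  rewrite (_ : e / 3 = (`|C| + 1) * (e / (3 * (`|C| + 1)))); last by field; rewrite gt_eqF.
  by apply: ler_wpM2r; [exact: ltW|rewrite (le_trans (ler_norm _))// lerDl].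
exists d => // s sT st.
rewrite (_ : _ - _ = (pairing (mu s) g - pairing (mu t) g)
  - (pairing (mu s) g - pairing (mu s) phi) + (pairing (mu t) g - pairing (mu t) phi));
    last by ring.
apply: (le_trans (ler_normD _ _)); apply: (le_trans (lerD (ler_normB _ _) (lexx _))).
have := hd s sT st; have := near s sT; have := near t tT.
lra.
Qed.

(** The regularity in time under which pairing with a weakly continuous bounded
    family stays continuous. *)
Definition unif_curve (b : R) (phi : R -> R -> R) : Prop :=
  (forall s, s \in `[0, b] -> continuous (phi s)) /\
  forall s e, s \in `[0, b] -> 0 < e -> exists2 d, 0 < d & forall r, r \in `[0, b] ->
    `|r - s| < d -> forall x, I01 x -> `|phi r x - phi s x| <= e.

Lemma pairing_curve_continuous b phi : b <= T -> unif_curve b phi ->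
  forall s e, s \in `[0, b] -> 0 < e -> exists2 d, 0 < d & forall r, r \in `[0, b] ->
    `|r - s| < d -> `|pairing (mu r) (phi r) - pairing (mu s) (phi s)| <= e.
Proof.
move=> bT [cphi uphi] s e sb e0.
have sub r : r \in `[0, b] -> r \in `[0, T].
  by rewrite !in_itv/= => /andP[-> /le_trans]; exact.
have C1 : 0 < `|C| + 1 by rewrite ltr_wpDl.
have a0 : 0 < e / (2 * (`|C| + 1)) by rewrite divr_gt0// mulr_gt0.
have e2 : 0 < e / 2 by rewrite divr_gt0.
have [d d0 hd] := uphi s _ sb a0.
have [d' d'0 hd'] := pairing_continuous (sub _ sb) (@cphi s sb) e2.
exists (Num.min d d'); first by rewrite lt_min d0.
move=> r rb; rewrite lt_min => /andP[rd rd'].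
have cr := cphi r rb; have cs := cphi s sb.
rewrite (_ : _ - _ = (pairing (mu r) (phi r) - pairing (mu r) (phi s)) +
  (pairing (mu r) (phi s) - pairing (mu s) (phi s))); last by ring.
apply: (le_trans (ler_normD _ _)).
rewrite -(daniell_sub (dP r)); try exact: bdd_meas01_cts.
have crs : continuous (fun x => phi r x - phi s x).
  by move=> x; apply: cvgB; [exact: cr|exact: cs].
have h1 := hd' r (sub _ rb) rd'.
have h2 := pairing_TV (sub _ rb) crs (hd r rb rd).
have : C * (e / (2 * (`|C| + 1))) <= e / 2.
  rewrite (_ : e / 2 = (`|C| + 1) * (e / (2 * (`|C| + 1)))); last by field; rewrite gt_eqF.
  by apply: ler_wpM2r; [exact: ltW|rewrite (le_trans (ler_norm _))// lerDl].
lra.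
Qed.

Lemma pairing_curve_measurable b phi : b <= T -> unif_curve b phi ->
  measurable_fun `[0, b] (fun s => pairing (mu s) (phi s)).
Proof.
move=> bT cphi; apply: subspace_continuous_measurable_fun => //.
by apply: within_itv_continuous => s sb e e0; exact: (pairing_curve_continuous bT cphi sb e0).
Qed.

Variables (f : R -> R) (f_ : nat -> R -> R) (K : R).
Hypothesis f_cts : forall n, continuous (f_ n).
Hypothesis f_K : forall n x, I01 x -> `|f_ n x| <= K.
Hypothesis f_f : forall x, I01 x -> f_ n x @[n --> \oo] --> f x.

Let K0 : 0 <= K.
Proof.
have I0 : I01 (0 : R) by apply/I01P; rewrite lexx ler01.
exact: le_trans (f_K 0 I0).
Qed.

Lemma bdd_meas01_density : bdd_meas01 f.
Proof.
apply: bdd_meas01_cvg f_K f_f => n.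
exact: bdd_meas01_measurable (bdd_meas01_cts (@f_cts n)).
Qed.

Lemma pairing_density_cvg s phi : continuous phi ->
  pairing (mu s) (fun x => f_ n x * phi x) @[n --> \oo]
    --> pairing (mu s) (fun x => f x * phi x).
Proof.
move=> cphi; have [B B0 hB] := cts_bounded_I01 cphi.
apply: (daniell_cvg (dP s) (M := K * B)).
- move=> n; apply: bdd_meas01_measurable; apply: bdd_meas01M; exact: bdd_meas01_cts.
- by move=> n x Ix; rewrite normrM ler_pM ?f_K ?hB.
- by move=> x Ix; apply: cvgMl; exact: f_f.
Qed.

Lemma pairing_density_bound s phi (M : R) : s \in `[0, T] -> continuous phi ->
  (forall x, I01 x -> `|phi x| <= M) ->
  `|pairing (mu s) (fun x => f x * phi x)| <= C * (K * M).
Proof.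
move=> sT cphi hM.
have hc : `|pairing (mu s) (fun x => f_ n x * phi x)| @[n --> \oo] -->
    `|pairing (mu s) (fun x => f x * phi x)|.
  by apply: cvg_norm; exact: pairing_density_cvg.
apply: (@closed_cvg _ _ _ _ _ [set y | y <= C * (K * M)] _ _ _ hc).
  exact: closed_le.
apply: nearW => n /=; apply: pairing_TV => //.
  by move=> x; apply: cvgM; [exact: f_cts|exact: cphi].
by move=> x Ix; rewrite normrM ler_pM ?f_K ?hM.
Qed.

(** For a continuous density this pairing is continuous in time. Measurability
    survives the discontinuities of [f] because [f] is a bounded pointwise limit
    of continuous functions. *)
Lemma pairing_density_measurable b phi : b <= T -> unif_curve b phi ->
  measurable_fun `[0, b] (fun s => pairing (mu s) (fun x => f x * phi s x)).
Proof.
move=> bT [cphi uphi].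
apply: (@measurable_fun_cvg _ _ _ _ (
  fun n s => pairing (mu s) (fun x => f_ n x * phi s x))) => //.
  move=> n; apply: (@pairing_curve_measurable b (fun s x => f_ n x * phi s x)) => //; split.
    by move=> s sb x; apply: cvgM; [exact: f_cts|exact: (@cphi s sb x)].
  move=> s e sb e0; have K1 : 0 < K + 1 by rewrite ltr_wpDl.
  have a0 : 0 < e / (K + 1) by rewrite divr_gt0.
  have [d d0 hd] := uphi s _ sb a0.
  exists d => // r rb rs x Ix; rewrite -mulrBr normrM.
  rewrite (_ : e = (K + 1) * (e / (K + 1))); last by field; rewrite gt_eqF.
  by apply: ler_pM => //; [rewrite (le_trans (f_K _ Ix))// lerDl|exact: hd].
by move=> s sb; apply: pairing_density_cvg; exact: cphi.
Qed.

End Curves.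

(** * Bochner integrals against test functions *)

Section Bochner.
Context {R : realType}.
Local Notation leb := (@lebesgue_measure R).

Lemma Rintegral_bigsum (D : set R) (N : nat) (g : 'I_N -> R -> R) : measurable D ->
  (forall i, leb.-integrable D (EFin \o g i)) ->
  leb.-integrable D (EFin \o (fun s => \sum_(i < N) g i s)) /\
  \int[leb]_(s in D) (\sum_(i < N) g i s) = \sum_(i < N) \int[leb]_(s in D) g i s.
Proof.
move=> mD; elim: N g => [|N IH] g ig.
  under eq_fun do rewrite big_ord0.
  rewrite big_ord0; split; first exact: integrable0.
  by rewrite /Rintegral integral0.
have [i1 e1] := IH (fun i => g (widen_ord (leqnSn N) i)) (fun i => ig _).
under eq_fun do rewrite big_ord_recr/=.
rewrite big_ord_recr/= -e1 -RintegralD//; split => //.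
exact: (@integrableD _ _ R leb D mD _ _ i1 (ig ord_max)).
Qed.

(** Evaluation at a test function of norm at most 1 is bounded by the dual norm,
    so the simple maps that approximate [g] in the sense of Bochner give simple
    functions that approximate [s |-> g s phi] in L^1. *)
Lemma bochner_pairing (t B : R) (g : R -> (R -> R) -> R) (J : (R -> R) -> R) phi :
  0 <= t -> is_bochner_integral `[0, t]%classic g J -> (BL_norm phi <= 1)%E ->
  measurable_fun `[0, t] (fun s => g s phi) ->
  (forall s, s \in `[0, t] -> `|g s phi| <= B) ->
  J phi = \int[leb]_(s in `[0, t]) g s phi.
Proof.
move=> t0 [u [mu cu cJ]] bl mg gB.
have ig := integrable_itv_bounded mg gB.
have simple n : leb.-integrable `[0, t] (EFin \o (fun s => simple_eval (u n) s phi)) /\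
    \int[leb]_(s in `[0, t]) simple_eval (u n) s phi = simple_integral (u n) phi.
  have i1 i : leb.-integrable `[0, t] (EFin \o (\1_(@simple_set _ _ (u n) i) : R -> R)).
    have [mS sS] := @simple_setP _ _ (u n) i.
    apply: (integrable_itv_bounded (c := 1)).
      by apply: measurable_indic.
    by move=> s _; rewrite indicE; case: (_ \in _); rewrite ?normr1 ?normr0.
  have [|h1 h2] := @Rintegral_bigsum `[0, t]%classic _
     (fun i s => \1_(@simple_set _ _ (u n) i) s * @simple_val _ _ (u n) i phi) (measurable_itv _).
    move=> i; have := @integrableZr _ _ R leb _ (measurable_itv _)
      (@simple_val _ _ (u n) i phi) _ (i1 i).
    by [].
  split => //; rewrite /simple_integral [LHS]h2; apply: eq_bigr => i _.
  rewrite RintegralZr//; congr (_ * _).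
  have [mS sS] := @simple_setP _ _ (u n) i.
  rewrite /Rintegral integral_indic//.
  by congr (fine (leb _)); apply/setIidPl.
apply/eqP; rewrite -subr_eq0 -normr_le0; apply/ler_addgt0Pl => e e0; rewrite addr0.
have e2 : 0 < e / 2 by rewrite divr_gt0.
have [n [h1 h2]] : exists n,
   (\int[leb]_(s in `[0%R, t]) BL_dual_norm (g s \- simple_eval (u n) s)%R < (e / 2)%:E)%E /\
   (BL_dual_norm (J \- simple_integral (u n))%R < (e / 2)%:E)%E.
  have [n1 _ hn1] := cu _ (nbhs0_lt e2); have [n2 _ hn2] := cJ _ (nbhs0_lt e2).
  exists (maxn n1 n2); split; [apply: hn1|apply: hn2] => /=; rewrite leq_max leqnn ?orbT//.
have [is_ es] := simple n.
have a1 : `|J phi - simple_integral (u n) phi| < e / 2.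
  by rewrite -lte_fin; apply: le_lt_trans h2; exact: (BL_dual_norm_ge _ bl).
have a2 : `|\int[leb]_(s in `[0, t]) g s phi - simple_integral (u n) phi| < e / 2.
  rewrite -es -RintegralB// -lte_fin; apply: le_lt_trans h1.
  have igs : leb.-integrable `[0, t]
     (EFin \o (fun s => g s phi - simple_eval (u n) s phi)).
    by have := @integrableB _ _ R leb _ (measurable_itv _) _ _ ig is_.
  rewrite EFin_normr_Rintegral//.
  have /integrableP[mgs _] := igs.
  apply: (le_trans (le_abse_integral _ _ mgs)) => //.
  apply: ge0_le_integral => //.
  - exact: measurableT_comp.
  - exact: mu.
  - by move=> s st; exact: (BL_dual_norm_ge _ bl).
rewrite (_ : _ - _ = (J phi - simple_integral (u n) phi) -
  (\int[leb]_(s in `[0, t]) g s phi - simple_integral (u n) phi)); last by ring.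
by apply: (le_trans (ler_normB _ _)); lra.
Qed.

End Bochner.

(** * The variation of constants formula against continuous functions *)

Section PushForward.
Context {R : realType}.
Implicit Types (m : {charge set R -> \bar R}) (v f phi Psi : R -> R).

Lemma pairing_density m f phi : bdd_meas01 f -> bdd_meas01 phi ->
  pairing (density f m) phi = pairing m (fun x => f x * phi x).
Proof.
move=> bf bphi; have dm := daniell_pairing m.
have dL : daniell (fun phi => pairing m (fun x => f x * phi x)).
  exact: (@daniell_density_comp _ _ f id dm bf (@measurable_id _ _ _)).
by rewrite (pairing_daniell dL).
Qed.

Lemma pairing_push_density m v f Psi phi t : bdd_meas01 f -> bdd_meas01 phi ->
  measurable_fun I01 Psi -> (forall x, I01 x -> I01 (Psi x)) ->
  (forall x, I01 x -> stopped_flow v t x = Psi x) ->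
  pairing (flow_push v t (density f m)) phi = pairing m (fun x => f x * phi (Psi x)).
Proof.
move=> bf bphi mP IP hP; have dm := daniell_pairing m.
have dL := daniell_density_comp dm bf mP IP.
rewrite (pairing_daniell dL)// => A mA; congr EFin.
apply: (daniell_eq dm) => x; rewrite inE => Ix /=.
by rewrite -hP.
Qed.

(** Outside [0,1] the stopped flow is the identity while [Psi] takes values in
    [0,1]; the two preimages differ by a set that carries no mass. *)
Lemma pairing_push m v Psi phi t : concentrated m -> bdd_meas01 phi ->
  continuous Psi -> (forall x, I01 x -> I01 (Psi x)) ->
  (forall x, I01 x -> stopped_flow v t x = Psi x) ->
  pairing (flow_push v t m) phi = pairing m (fun x => phi (Psi x)).
Proof.
move=> cm bphi cP IP hP; have dm := daniell_pairing m.
have mP : measurable_fun [set: R] Psi by exact: continuous_measurable_fun.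
have mPI : measurable_fun I01 Psi by exact: measurable_funTS.
have dL : daniell (fun phi => pairing m (fun x => phi (Psi x))).
  have := daniell_density_comp dm (bdd_meas01_cst 1) mPI IP.
  by under eq_fun do under eq_fun do rewrite mul1r.
rewrite (pairing_daniell dL)// => A mA.
have mI := @measurable_I01 R.
have mPA : measurable (Psi @^-1` A) by rewrite -[X in measurable X]setTI; exact: mP.
have mPAI : measurable (Psi @^-1` A `&` I01) by exact: measurableI.
have mAI : measurable (A `\` I01) by exact: measurableD.
rewrite -[RHS]/((pairing m \1_(Psi @^-1` A))%:E) pairing_indic//.
rewrite /flow_push /pushforward.
have -> : stopped_flow v t @^-1` A = (Psi @^-1` A `&` I01) `|` (A `\` I01).
  apply/seteqP; split => x /=.
    by have [Ix|nI] := pselect (I01 x);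
      [rewrite hP//; left|rewrite stopped_flow_outside//; right].
  by move=> [[Ax Ix]|[Ax nI]]; [rewrite hP|rewrite stopped_flow_outside].
rewrite chargeU//; last by rewrite -subset0 => x /= [[_ Ix] [_]].
by rewrite (cm (A `\` I01))// ?adde0// setDE -setIA setICl setI0.
Qed.

End PushForward.

Section MildPairing.
Context {R : realType}.
Local Notation leb := (@lebesgue_measure R).
Variables (v f : R -> R) (nu0 : {charge set R -> \bar R}).
Variables (mu : R -> {charge set R -> \bar R}) (T C : R).
Hypothesis muTV : forall t, t \in `[0, T] -> (TV_norm (mu t) <= C%:E)%E.
Hypothesis muC : forall t, t \in `[0, T] ->
  BL_dual_norm (pairing (mu s) \- pairing (mu t))
    @[s --> within `[0, T]%classic (nbhs t)] --> 0%E.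
Variables (f_ : nat -> R -> R) (K : R).
Hypothesis f_cts : forall n, continuous (f_ n).
Hypothesis f_K : forall n x, I01 x -> `|f_ n x| <= K.
Hypothesis f_f : forall x, I01 x -> f_ n x @[n --> \oo] --> f x.
Hypothesis nu0I : concentrated nu0.
Hypothesis muB : forall t, t \in `[0, T] ->
  is_bochner_integral `[0, t]%classic
    (fun s => pairing (flow_push v (t - s) (density f (mu s))))
    (pairing (mu t) \- pairing (flow_push v t nu0)).
Variables (Psi : R -> R -> R) (L : R).
Hypothesis L0 : 0 < L.
Hypothesis PsiE : forall t x, 0 <= t -> I01 x -> stopped_flow v t x = Psi t x.
Hypothesis PsiI : forall t x, I01 (Psi t x).
Hypothesis Psi_cts : forall t, 0 <= t -> continuous (Psi t).
Hypothesis Psi_lip : forall t h x, 0 <= t -> 0 <= h -> I01 x ->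
  `|Psi (t + h) x - Psi t x| <= L * h.

Local Notation dP t := (daniell_pairing (mu t)).
Let bf : bdd_meas01 f := bdd_meas01_density f_cts f_K f_f.

Lemma flow_dist s t x : 0 <= s -> 0 <= t -> I01 x -> `|Psi s x - Psi t x| <= L * `|s - t|.
Proof.
move=> s0 t0 Ix; wlog st : s t s0 t0 / s <= t.
  by move=> h; have [/h|/ltW/h] := leP s t; [exact|rewrite distrC (distrC s); exact].
have h0 : 0 <= t - s by rewrite subr_ge0.
rewrite distrC (distrC s) (ger0_norm h0).
by have := Psi_lip s0 h0 Ix; rewrite (_ : s + (t - s) = t)//; ring.
Qed.

Lemma flow_unif_curve t phi : 0 <= t -> continuous phi ->
  unif_curve t (fun s x => phi (Psi (t - s) x)).
Proof.
move=> t0 cphi; split=> [s|s e].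
  rewrite in_itv/= => /andP[s0 st] x; apply: continuous_comp; last exact: cphi.
  by apply: Psi_cts; rewrite subr_ge0.
rewrite in_itv/= => /andP[s0 st] e0; have [d d0 hd] := cts_unif_I01 cphi e0.
exists (d / L); first by rewrite divr_gt0.
move=> r; rewrite in_itv/= => /andP[r0 rt] rs x Ix; apply: hd => //.
apply: (le_lt_trans (flow_dist _ _ Ix)); rewrite ?subr_ge0//.
rewrite (_ : t - r - (t - s) = - (r - s)); last by ring.
by rewrite normrN mulrC -ltr_pdivlMr.
Qed.

Lemma flow_density_integrable t phi : t \in `[0, T] -> continuous phi ->
  leb.-integrable `[0, t]
    (EFin \o (fun s => pairing (mu s) (fun x => f x * phi (Psi (t - s) x)))).
Proof.
rewrite in_itv/= => /andP[t0 tT] cphi; have [B B0 hB] := cts_bounded_I01 cphi.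
have [cc cu] := flow_unif_curve t0 cphi.
apply: (integrable_itv_bounded (c := C * (K * B))).
  exact: (pairing_density_measurable muTV muC f_cts f_K f_f tT).
move=> s st; apply: (pairing_density_bound muTV f_cts f_K f_f) => //; last first.
- by move=> x _; exact: hB.
- exact: (cc s st).
- by move: st; rewrite !in_itv/= => /andP[-> /le_trans]; exact.
Qed.

(** The Bochner integral gives the formula for test functions in the unit ball,
    hence by scaling for Lipschitz ones. Continuous ones are uniform limits of
    those, and every term is bounded by a multiple of the sup norm of [phi].
    The derivative of a test function along the flow is only continuous, which
    is why this extension is needed. *)
Lemma mild_pairing t phi : t \in `[0, T] -> continuous phi ->
  pairing (mu t) phi = pairing nu0 (fun x => phi (Psi t x)) +
    \int[leb]_(s in `[0, t]) pairing (mu s) (fun x => f x * phi (Psi (t - s) x)).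
Proof.
move=> tT; have := tT; rewrite in_itv/= => /andP[t0 tT'].
have sT s : s \in `[0, t] -> s \in `[0, T].
  by rewrite !in_itv/= => /andP[-> /le_trans]; exact.
have mPsi s : 0 <= s -> measurable_fun I01 (Psi s).
  by move=> s0; apply: bdd_meas01_measurable; apply: bdd_meas01_cts; exact: Psi_cts.
pose I g := \int[leb]_(s in `[0, t]) pairing (mu s) (fun x => f x * g (Psi (t - s) x)).
pose N g := pairing nu0 (fun x => g (Psi t x)).
have cN (g : R -> R) : continuous g -> continuous (fun x => g (Psi t x)).
  by move=> cg x; apply: continuous_comp; [exact: Psi_cts|exact: cg].
have cS (g : R -> R) s : continuous g -> s \in `[0, t] -> bdd_meas01 (fun x => f x * g (Psi (t - s) x)).
  move=> cg; rewrite in_itv/= => /andP[s0 st]; apply: bdd_meas01M => //.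
  apply: bdd_meas01_cts => x.
  by apply: continuous_comp; [apply: Psi_cts; rewrite subr_ge0|exact: cg].
have ball (g : R -> R) : continuous g -> (BL_norm g <= 1)%E -> pairing (mu t) g = N g + I g.
  move=> cg bl; have [B B0 hB] := cts_bounded_I01 cg.
  have bg := bdd_meas01_cts cg.
  have E s : s \in `[0, t] -> pairing (flow_push v (t - s) (density f (mu s))) g =
      pairing (mu s) (fun x => f x * g (Psi (t - s) x)).
    rewrite in_itv/= => /andP[s0 st]; have ts : 0 <= t - s by rewrite subr_ge0.
    by apply: pairing_push_density => //; [exact: mPsi|move=> x Ix; exact: PsiE].
  have ig := flow_density_integrable tT cg.
  have [mi _] := integrableP _ _ _ ig.
  have := bochner_pairing (B := C * (K * B)) t0 (muB tT) bl.
  rewrite (_ : \int[leb]_(s in _) _ = I g); last first.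
    by apply: eq_Rintegral => s; rewrite inE => st; exact: E.
  rewrite /= (pairing_push nu0I bg (Psi_cts t0))//; last by move=> x; exact: PsiE.
  move=> H; rewrite addrC; apply/eqP; rewrite -subr_eq; apply/eqP; apply: H.
    move/measurable_EFinP : mi; apply: eq_measurable_fun => s; rewrite inE => st.
    by rewrite E.
  move=> s st; rewrite E//; apply: (pairing_density_bound muTV f_cts f_K f_f (sT _ st)).
    have [cc _] := flow_unif_curve t0 cg; exact: (cc s st).
  by move=> x _; exact: hB.
have IZ c (g : R -> R) : continuous g -> I (fun x => c * g x) = c * I g.
  move=> cg; rewrite /I -RintegralZl//; last exact: flow_density_integrable.
  apply: eq_Rintegral => s; rewrite inE => st.
  by rewrite -(daniellZ (dP s) _ (cS g s cg st)); congr pairing; apply/funext => x; ring.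
have IB (g1 g2 : R -> R) : continuous g1 -> continuous g2 -> I (fun x => g1 x - g2 x) = I g1 - I g2.
  move=> c1 c2; rewrite /I -RintegralB//; try exact: flow_density_integrable.
  apply: eq_Rintegral => s; rewrite inE => st.
  rewrite -(daniell_sub (dP s) (cS g1 s c1 st) (cS g2 s c2 st)).
  by congr pairing; apply/funext => x; ring.
have lip (g : R -> R) k : continuous g -> (forall x y, `|g x - g y| <= k * `|x - y|) ->
    pairing (mu t) g = N g + I g.
  move=> cg hk; have [c c0 bl] := lipschitz_scale_BL cg hk.
  have ccg : continuous (fun x => c * g x) by move=> x; apply: cvgMr; exact: cg.
  have := ball _ ccg bl; rewrite IZ// (daniellZ (dP t) _ (bdd_meas01_cts cg)).
  rewrite /N (daniellZ (daniell_pairing nu0) _ (bdd_meas01_cts (cN _ cg))) -mulrDr.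
  by move/(mulfI (lt0r_neq0 c0)).
move=> cphi; have [C0 C00 hC0] := pairing_bound nu0.
pose Ct := C + C0 + C * K * t.
apply/eqP; rewrite -subr_eq0 -normr_le0; apply/ler_addgt0Pl => e e0; rewrite addr0.
have Ct1 : 0 < `|Ct| + 1 by rewrite ltr_wpDl.
have a0 : 0 < e / (`|Ct| + 1) by rewrite divr_gt0.
have [g [k [gk gphi]]] := lipschitz_approx cphi a0.
have cg : continuous g by exact: lipschitz_continuous gk.
have cgp : continuous (fun x => g x - phi x).
  by move=> x; apply: cvgB; [exact: cg|exact: cphi].
set a := e / (`|Ct| + 1) in a0 gphi.
have e1 : `|pairing (mu t) (fun x => g x - phi x)| <= C * a by exact: (pairing_TV muTV).
have e2 : `|N (fun x => g x - phi x)| <= C0 * a.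
  apply: hC0; first exact: bdd_meas01_cts (cN _ cgp).
  by move=> x _; exact: gphi.
have e3 : `|I (fun x => g x - phi x)| <= C * K * t * a.
  rewrite (_ : C * K * t * a = C * (K * a) * (t - 0)); last by ring.
  have ig := flow_density_integrable tT cgp.
  have [/measurable_EFinP mi _] := integrableP _ _ _ ig.
  apply: Rintegral_itv_bound => // s st.
  apply: (pairing_density_bound muTV f_cts f_K f_f (sT _ st)).
    have [cc _] := flow_unif_curve t0 cgp; exact: (cc s st).
  by move=> x _; exact: gphi.
move: e1 e2 e3; rewrite IB// /N (daniell_sub (dP t)); try exact: bdd_meas01_cts.
rewrite (daniell_sub (daniell_pairing nu0)); try (apply: bdd_meas01_cts; exact: cN).
rewrite (lip g k cg gk) -/(N g) -/(N phi) -/(I phi) => e1 e2 e3.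
rewrite (_ : _ - _ = - (N g + I g - pairing (mu t) phi) + (N g - N phi) + (I g - I phi));
  last by ring.
apply: (le_trans (ler_normD _ _)); apply: (le_trans (lerD (ler_normD _ _) (lexx _))).
rewrite normrN.
apply: (@le_trans _ _ (Ct * a)); first by rewrite /Ct !mulrDl; lra.
apply: (@le_trans _ _ ((`|Ct| + 1) * a)).
  by apply: ler_wpM2r; [exact: ltW|rewrite (le_trans (ler_norm _))// lerDl].
by rewrite /a mulrC divfK// gt_eqF.
Qed.

End MildPairing.

(** * Mild solutions are weak solutions *)

Section RectBounded.
Context {R : realType}.

Lemma rect_bounded (a b c d : R) (g : R -> R -> R) :
  {within `[a, b]%classic `*` `[c, d]%classic, continuous (fun p : R * R => g p.1 p.2)} ->
  exists2 B, 0 <= B & forall x s, x \in `[a, b] -> s \in `[c, d] -> `|g x s| <= B.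
Proof.
move=> cg; have cQ : compact (`[a, b]%classic `*` `[c, d]%classic : set (R * R)).
  by apply: compact_setX; exact: segment_compact.
have [M [_ hM]] := compact_bounded (continuous_compact cg cQ).
exists (`|M| + 1); first by rewrite addr_ge0.
move=> x s xab scd; apply: (hM (`|M| + 1)).
  by rewrite ltr_pwDr// ler_norm.
by exists (x, s).
Qed.

(** Over n equal steps shorter than [d] the increments add up to at most a
    multiple of [e]. *)
Lemma uniform_little_o_constant (T : R) (H : R -> R) : 0 <= T ->
  (forall e, 0 < e -> exists2 d, 0 < d & forall t h, 0 <= t -> 0 <= h -> h < d -> t + h <= T ->
     `|H (t + h) - H t| <= e * h) ->
  H T = H 0.
Proof.
move=> T0 hH; apply/eqP; rewrite -subr_eq0 -normr_le0; apply/ler_addgt0Pl => e e0.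
rewrite addr0; have T1 : 0 < T + 1 by rewrite ltr_wpDl.
have [d d0 hd] := hH (e / (T + 1)) (divr_gt0 e0 T1).
pose n := Num.bound (T / d).
have nTd : T / d < n%:R by apply: archi_boundP; rewrite divr_ge0// ltW.
have n0 : 0 < n%:R :> R by apply: le_lt_trans nTd; rewrite divr_ge0// ltW.
have nd : T / n%:R < d by rewrite ltr_pdivrMr// mulrC -ltr_pdivrMr.
pose h := T / n%:R.
have h0 : 0 <= h by rewrite divr_ge0// ltW.
have step k : (k <= n)%N -> `|H (k%:R * h) - H 0| <= e / (T + 1) * (k%:R * h).
  elim: k => [|k IH] kn; first by rewrite !mul0r subrr normr0 mulr0.
  have kh : k.+1%:R * h = k%:R * h + h by rewrite -natr1 mulrDl mul1r.
  rewrite kh (_ : _ - _ = (H (k%:R * h + h) - H (k%:R * h)) + (H (k%:R * h) - H 0)); last by ring.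
  apply: (le_trans (ler_normD _ _)); rewrite mulrDr addrC.
  apply: lerD; first by apply: IH; exact: ltnW.
  apply: hd => //; first by rewrite mulr_ge0.
  rewrite -kh /h mulrCA ler_piMr// ler_pdivrMr// mul1r ler_nat//.
have := step n (leqnn _); rewrite /h mulrCA divff ?gt_eqF// mulr1.
move=> /le_trans; apply.
by rewrite -mulrA ler_piMr ?(ltW e0)// mulrC ler_pdivrMr// mul1r lerDl.
Qed.

End RectBounded.

Section TestFunctionAlongFlow.
Context {R : realType}.
Variables (T : R) (psi psi_x psi_t : R -> R -> R) (v : R -> R).
Hypothesis psi_test : test_function T psi psi_x psi_t.
Variables (Psi : R -> R -> R) (L : R).
Hypothesis L0 : 0 < L.
Hypothesis vL : forall x, I01 x -> `|v x| <= L.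
Hypothesis PsiI : forall t x, I01 (Psi t x).
Hypothesis Psi_step : forall t h x, 0 <= t -> 0 <= h -> I01 x ->
  `|Psi (t + h) x - Psi t x| <= L * h /\
  ((exists2 b, b = 0 \/ b = 1 & `|Psi t x - b| <= L * h) \/
   `|Psi (t + h) x - Psi t x - h * v (Psi t x)| <= L * h ^+ 2).

(** Along the stopped flow a test function has derivative [psi_t + psi_x v],
    uniformly. Away from the ends this is the chain rule; within one step of an
    end the Euler estimate is lost, but there [psi_x] is small, since it
    vanishes at the ends. *)
Lemma test_function_along_flow e : 0 < e -> exists2 d, 0 < d & forall t h r x,
  0 <= t -> 0 <= h -> h < d -> t + h <= T -> 0 <= r -> I01 x ->
  `|psi (Psi (r + h) x) (t + h) - psi (Psi r x) t
    - h * (psi_t (Psi r x) t + psi_x (Psi r x) t * v (Psi r x))| <= e * h.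
Proof.
move=> e0; have [[_ cx ct D] bd] := psi_test.
have K0 : 0 < 2 + 3 * L by rewrite addr_gt0// mulr_gt0.
(* the errors below are e1 h for time, L e1 h for space, (1 + 2 L) e1 h at the ends *)
pose e1 := e / (2 + 3 * L).
have e10 : 0 < e1 by rewrite divr_gt0.
have [dx dx0 hdx] := rect_unif_continuous cx e10.
have [dt dt0 hdt] := rect_unif_continuous ct e10.
have [B B0 hB] := rect_bounded cx.
have BL0 : 0 < B * L + 1 by rewrite ltr_wpDl// mulr_ge0// ltW.
exists (Num.min (Num.min dx (dx / L)) (Num.min dt (e1 / (B * L + 1)))).
  by rewrite !lt_min dx0 dt0 !divr_gt0.
move=> t h r x t0 h0; rewrite !lt_min => /andP[/andP[hx hxL] /andP[ht hB1]] thT r0 Ix.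
have [y1y ystep] := Psi_step r0 h0 Ix.
set y := Psi r x in y1y ystep *; set y1 := Psi (r + h) x in y1y ystep *.
have Iy : y \in `[0, 1] by exact: PsiI.
have Iy1 : y1 \in `[0, 1] by exact: PsiI.
have tT : t \in `[0, T] by rewrite in_itv/=; lra.
have thT' : t + h \in `[0, T] by rewrite in_itv/=; lra.
have Lh : L * h < dx by rewrite mulrC -ltr_pdivlMr.
have [z [zI zy Ez]] : exists z, [/\ z \in `[0, 1], `|z - y| <= `|y1 - y| &
    psi y1 (t + h) - psi y (t + h) = psi_x z (t + h) * (y1 - y)].
  apply: (@mvt_within_dist _ 0 1 (fun x => psi x (t + h)) (fun x => psi_x x (t + h))) => //.
  by move=> w wI; have [] := D w (t + h) (conj wI thT').
have [u [uT ut Eu]] : exists u, [/\ u \in `[0, T], `|u - t| <= `|t + h - t| &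
    psi y (t + h) - psi y t = psi_t y u * (t + h - t)].
  apply: (@mvt_within_dist _ 0 T (psi y) (psi_t y)) => //.
  by move=> w wT; have [] := D y w (conj Iy wT).
have tht : t + h - t = h by ring.
rewrite tht in Eu ut; rewrite (ger0_norm h0) in ut.
have E1 : `|psi_x z (t + h) - psi_x y t| <= e1.
  apply: hdx => //; first by apply: le_lt_trans Lh; exact: le_trans zy y1y.
  by rewrite tht ger0_norm.
have E2 : `|psi_t y u - psi_t y t| <= e1.
  by apply: hdt => //; [rewrite subrr normr0|exact: le_lt_trans ht].
have E3 : `|psi_x y t * (y1 - y - h * v y)| <= e1 * (1 + 2 * L) * h.
  case: ystep => [[b b01 yb]|sm].
    have Ib : b \in `[0, 1] by rewrite in_itv/=; case: b01 => ->; rewrite lexx ler01.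
    have pb : psi_x b t = 0 by have [h1 h2] := bd t tT; case: b01 => ->.
    have : `|psi_x y t - psi_x b t| <= e1.
      apply: hdx => //; last by rewrite subrr normr0.
      exact: le_lt_trans Lh.
    rewrite pb subr0 => px.
    have : `|y1 - y - h * v y| <= 2 * L * h.
      apply: (le_trans (ler_normB _ _)); rewrite normrM (ger0_norm h0).
      have : h * `|v y| <= h * L by apply: ler_wpM2l => //; exact: vL.
      lra.
    move=> hs; rewrite normrM.
    apply: (@le_trans _ _ (e1 * (2 * L * h))); first exact: ler_pM.
    have : 0 <= e1 * h by rewrite mulr_ge0// ltW.
    lra.
  rewrite normrM; apply: (@le_trans _ _ (B * (L * h ^+ 2))).
    by apply: ler_pM => //; exact: hB.
  have hh : (B * L + 1) * h <= e1 by rewrite mulrC -ler_pdivlMr// ltW.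
  have : (B * L + 1) * h * h <= e1 * h by apply: ler_wpM2r.
  have : 0 <= e1 * L * h.
    by apply: mulr_ge0 => //; apply: mulr_ge0; exact: ltW.
  have : 0 <= h * h by rewrite mulr_ge0.
  rewrite expr2; lra.
rewrite (_ : _ - _ - _ = (psi_x z (t + h) - psi_x y t) * (y1 - y) +
  (psi_t y u - psi_t y t) * h + psi_x y t * (y1 - y - h * v y)); last first.
  have -> : psi y1 (t + h) - psi y t =
      (psi y1 (t + h) - psi y (t + h)) + (psi y (t + h) - psi y t) by ring.
  by rewrite Ez Eu; ring.
apply: (le_trans (ler_normD _ _)); apply: (le_trans (lerD (ler_normD _ _) (lexx _))).
rewrite (normrM (_ - _) (y1 - y)) (normrM _ h) (ger0_norm h0).
have : `|psi_x z (t + h) - psi_x y t| * `|y1 - y| <= e1 * (L * h) by exact: ler_pM.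
have : `|psi_t y u - psi_t y t| * h <= e1 * h by exact: ler_wpM2r.
have -> : e = e1 * (2 + 3 * L) by rewrite /e1 divfK// gt_eqF.
lra.
Qed.

End TestFunctionAlongFlow.

Unset Implicit Arguments.

Theorem theorem3p5 (R : realType) (T : R) (v f : R -> R)
    (nu0 : {charge set R -> \bar R}) (mu : R -> {charge set R -> \bar R}) :
  0 <= T ->
  bounded_lipschitz I01 v ->
  piecewise_bounded_lipschitz f ->
  (forall x, x \in `[0, 1] -> ~ continuous_at01 f x -> v x != 0) ->
  concentrated nu0 ->
  mild_solution T v f nu0 mu ->
  weak_solution T v f nu0 mu.
Proof.
move=> T0 v_bl /piecewise_approx[f_ [K [f_cts f_K f_f]]] _ nu0I [_ muC [C muTV] muB].
have [Psi [L [L0 vL [PsiE PsiI Psi_cts Psi0 Psi_step]]]] := stopped_flow_regular v_bl.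
have Psi_lip t h x : 0 <= t -> 0 <= h -> I01 x -> `|Psi (t + h) x - Psi t x| <= L * h.
  by move=> t0 h0 Ix; have [] := Psi_step t h x t0 h0 Ix.
have mild := mild_pairing muTV muC f_cts f_K f_f nu0I muB L0 PsiE PsiI Psi_cts Psi_lip.
have bf := bdd_meas01_density f_cts f_K f_f.
move=> psi psi_x psi_t psi_test transport growth.
have [[cpsi cx ct _] _] := psi_test.
pose leb := @lebesgue_measure R.
pose gA x t := psi_t x t + psi_x x t * frozen_field v x.
pose p t x := psi (clamp01 x) t.
pose A t x := gA (clamp01 x) t.
have K0 : 0 <= K.
  have I0 : I01 (0 : R) by apply/I01P; rewrite lexx ler01.
  exact: le_trans (f_K 0%N 0 I0).
have C0 : 0 <= C.
  have := @pairing_TV _ mu T C muTV 0 (fun=> 1) 1.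
  rewrite in_itv/= lexx T0 mulr1 => H; apply: le_trans (normr_ge0 _) (H isT _ _).
    exact: cst_continuous.
  by move=> x _; rewrite normr1.
(* clamping the space variable makes the slices of a function that is continuous
   on the rectangle continuous on the whole line *)
have curve (g : R -> R -> R) :
    {within I01 `*` `[0, T]%classic, continuous (fun p : R * R => g p.1 p.2)} ->
    unif_curve T (fun t x => g (clamp01 x) t).
  move=> cg; split=> [s sT|s e sT e0].
    apply: (@continuous_clamp R (fun x => g x s)) => x e Ix e0.
    have [d d0 hd] := rect_unif_continuous cg e0; exists d => // y Iy yx.
    by apply: hd => //; rewrite subrr normr0.
  have [d d0 hd] := rect_unif_continuous cg e0; exists d => // r rT rs x Ix.
  by apply: hd => //; rewrite ?subrr ?normr0//; exact: clamp01_in.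
have cgA : {within I01 `*` `[0, T]%classic, continuous (fun p : R * R => gA p.1 p.2)}.
  have [K' [K'0 _ vL']] := bounded_lipschitz_ex v_bl.
  have cV : continuous (frozen_field v).
    exact: lipschitz_continuous (frozen_field_lip K'0 vL').
  have cV1 : {within I01 `*` `[0, T]%classic, continuous (fun p : R * R => frozen_field v p.1)}.
    by apply: continuous_subspaceT => q; apply: continuous_comp; [exact: cvg_fst|exact: cV].
  by move=> q; apply: cvgD; [exact: ct|apply: cvgM; [exact: cx|exact: cV1]].
have cp := curve _ cpsi; have cA := curve _ cgA.
have pI t x : I01 x -> p t x = psi x t by move=> Ix; rewrite /p clamp01_id.
have AI t x : I01 x -> A t x = psi_t x t + psi_x x t * v x.
  by move=> Ix; rewrite /A /gA clamp01_id// frozen_fieldE.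
pose F t := pairing (mu t) (p t).
pose a t := pairing (mu t) (A t).
pose g t := pairing (mu t) (fun x => f x * p t x).
have transportE t : transport t = a t.
  by apply: (daniell_eq (daniell_pairing (mu t))) => x; rewrite inE => Ix; rewrite AI.
have growthE t : t \in `[0, T] -> growth t = g t.
  move=> tT; have bp : bdd_meas01 (fun x => psi x t).
    apply: (bdd_meas01_eq (phi := p t)); last exact: bdd_meas01_cts (cp.1 t tT).
    by move=> x; rewrite inE; exact: pI.
  rewrite /growth pairing_density//; apply: (daniell_eq (daniell_pairing (mu t))) => x.
  by rewrite inE => Ix; rewrite pI.
have ca : {within `[0, T], continuous a}.
  apply: within_itv_continuous => s sT e e0.
  exact: (pairing_curve_continuous muTV muC (lexx T) cA sT e0).
have ia : leb.-integrable `[0, T] (EFin \o a).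
  by apply: continuous_compact_integrable => //; exact: segment_compact.
have [B B0 hB] := rect_bounded cpsi.
have ig : leb.-integrable `[0, T] (EFin \o g).
  apply: (integrable_itv_bounded (c := C * (K * B))).
    exact: (pairing_density_measurable muTV muC f_cts f_K f_f (lexx T) cp).
  move=> s sT; apply: (pairing_density_bound muTV f_cts f_K f_f sT (cp.1 s sT)) => x Ix.
  by apply: hB => //; exact: clamp01_in.
have sub t : t \in `[0, T] -> `[0, t]%classic `<=` `[0, T]%classic.
  by rewrite in_itv/= => /andP[t0 tT]; apply: subset_itvl; rewrite bnd_simp.
(* the weak formulation now says that F minus its primitive is constant *)
suff main : F T - \int[leb]_(s in `[0, T]) a s - \int[leb]_(s in `[0, T]) g s = F 0.
  have et : \int[leb]_(s in `[0, T]) transport s = \int[leb]_(s in `[0, T]) a s.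
    by apply: eq_Rintegral => s _; exact: transportE.
  have eg : \int[leb]_(s in `[0, T]) growth s = \int[leb]_(s in `[0, T]) g s.
    by apply: eq_Rintegral => s; rewrite inE => sT; exact: growthE.
  split.
  - by rewrite (_ : transport = a); [exact: ia|apply/funext => s; exact: transportE].
  - apply: eq_integrable ig; first exact: measurable_itv.
    by move=> s; rewrite inE => sT; congr EFin; rewrite -growthE.
  - rewrite -/leb et eg.
    have O_ : 0 \in `[0, T] by rewrite in_itv/= lexx T0.
    have -> : pairing (mu T) (fun x => psi x T) = F T.
      by apply: (daniell_eq (daniell_pairing (mu T))) => x; rewrite inE => Ix; rewrite pI.
    have -> : pairing nu0 (fun x => psi x 0) = F 0.
      rewrite /F (mild 0 (p 0) O_ (cp.1 0 O_)) set_itv1 Rintegral_set1 addr0.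
      apply: (daniell_eq (daniell_pairing nu0)) => x; rewrite inE => Ix.
      by rewrite /= (Psi0 _ Ix) (pI _ _ Ix).
    have cancel (x y z : R) : x - (x - y - z) = y + z by ring.
    by rewrite -main; exact: cancel.
pose H t := F t - \int[leb]_(s in `[0, t]) a s - \int[leb]_(s in `[0, t]) g s.
have -> : F 0 = H 0 by rewrite /H !set_itv1 !Rintegral_set1 !subr0.
apply: (@uniform_little_o_constant _ T H T0) => e e0.
have [D D0 hD] := pairing_bound nu0.
(* the four summands are the constants in b1, b2, b3, b4 *)
pose Q := D + C * K * T + C * K + 1.
have CK0 : 0 <= C * K by exact: mulr_ge0.
have Q0 : 0 < Q by rewrite /Q ltr_wpDl// !addr_ge0// mulr_ge0.
pose e1 := e / Q.
have e10 : 0 < e1 by exact: divr_gt0.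
have [d1 d10 hd1] := test_function_along_flow psi_test L0 vL PsiI Psi_step e10.
have [d2 d20 hd2] := rect_unif_continuous cpsi e10.
have [d3 d30 hd3] : exists2 d, 0 < d & forall s t, s \in `[0, T] -> t \in `[0, T] ->
    `|t - s| < d -> `|a t - a s| <= e1.
  have [|d d0 hd] := @rect_unif_continuous R 0 T 0 T (fun s _ => a s) _ e1 e10.
    apply/subspace_continuousP => -[s u] [/= sT uT]; apply/cvgrPdist_le => e' e'0.
    have [d d0 hd] := pairing_curve_continuous muTV muC (lexx T) cA sT e'0.
    apply/nbhs_ballP; exists d => // -[r w] /= [rs _] [/= rT _].
    by rewrite distrC; apply: hd => //; rewrite distrC.
  by exists d => // s t sT tT st; apply: (hd s t 0 0) => //;
    rewrite ?subrr ?normr0// in_itv/= lexx T0.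
exists (Num.min (Num.min d1 d3) (Num.min d2 (d2 / L))).
  by rewrite !lt_min d10 d20 d30 divr_gt0.
move=> t h t0 h0; rewrite !lt_min => /andP[/andP[hd1' hd3'] /andP[hd2' hd2L]] thT.
have Lh : L * h < d2 by rewrite mulrC -ltr_pdivlMr.
have th0 : 0 <= t + h by exact: addr_ge0.
have tth : t <= t + h by rewrite lerDl.
have tT : t <= T by exact: le_trans thT.
have tI : t \in `[0, T] by rewrite in_itv/= t0.
have thI : t + h \in `[0, T] by rewrite in_itv/= th0.
have cpt := cp.1 t tI; have cpth := cp.1 (t + h) thI; have cAt := cA.1 t tI.
(* integrands of the variation of constants formula for p (t + h) at time t + h,
   and for p t and A t at time t *)
pose X1 s := pairing (mu s) (fun x => f x * p (t + h) (Psi (t + h - s) x)).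
pose X2 s := pairing (mu s) (fun x => f x * p t (Psi (t - s) x)).
pose X3 s := pairing (mu s) (fun x => f x * A t (Psi (t - s) x)).
have integ u phi uI cphi := flow_density_integrable muTV muC f_cts f_K f_f L0
  PsiI Psi_cts Psi_lip (t := u) (phi := phi) uI cphi.
have i1 : leb.-integrable `[0, t + h] (EFin \o X1) by exact: integ.
have i2 : leb.-integrable `[0, t] (EFin \o X2) by exact: integ.
have i3 : leb.-integrable `[0, t] (EFin \o X3) by exact: integ.
have sub0t : `[0, t]%classic `<=` `[0, t + h]%classic by apply: subset_itvl; rewrite bnd_simp.
have subth : `[t, t + h]%classic `<=` `[0, t + h]%classic by apply: subset_itvr; rewrite bnd_simp.
have i10 : leb.-integrable `[0, t] (EFin \o X1) by exact: integrableS i1.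
have i1h : leb.-integrable `[t, t + h] (EFin \o X1) by exact: integrableS i1.
have igT : leb.-integrable `[0, t + h] (EFin \o g) by apply: integrableS ig => //; exact: sub.
have iaT : leb.-integrable `[0, t + h] (EFin \o a) by apply: integrableS ia => //; exact: sub.
have igh : leb.-integrable `[t, t + h] (EFin \o g) by exact: integrableS igT.
have iah : leb.-integrable `[t, t + h] (EFin \o a) by exact: integrableS iaT.
have cN u w : 0 <= u -> continuous w -> continuous (fun x => w (Psi u x) : R).
  by move=> u0 cw x; apply: continuous_comp; [exact: Psi_cts|exact: cw].
have bN u w : 0 <= u -> continuous w -> bdd_meas01 (fun x => w (Psi u x) : R).
  by move=> u0 cw; apply: bdd_meas01_cts; exact: cN.
pose Rm r x := p (t + h) (Psi (r + h) x) - p t (Psi r x) - h * A t (Psi r x).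
have cRm r : 0 <= r -> continuous (Rm r).
  move=> r0 x; apply: cvgB; first apply: cvgB; last apply: cvgMr.
  - by apply: (cN (r + h) (p (t + h)) _ cpth); rewrite addr_ge0.
  - exact: (cN r (p t) r0 cpt).
  - exact: (cN r (A t) r0 cAt).
have Rm_bound r x : 0 <= r -> I01 x -> `|Rm r x| <= e1 * h.
  move=> r0 Ix; rewrite /Rm (pI _ _ (PsiI _ _)) (pI _ _ (PsiI _ _)) (AI _ _ (PsiI _ _)).
  exact: hd1.
pose N u w := pairing nu0 (fun x => w (Psi u x) : R).
have b1 : `|N (t + h) (p (t + h)) - N t (p t) - h * N t (A t)| <= D * (e1 * h).
  have dN := daniell_pairing nu0.
  have bA := bN t (A t) t0 cAt; have bp := bN t (p t) t0 cpt.
  have bph := bN (t + h) (p (t + h)) th0 cpth.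
  rewrite /N -(daniellZ dN h bA) -(daniell_sub dN bph bp).
  rewrite -(daniell_sub dN (bdd_meas01B bph bp) (bdd_meas01Z h bA)).
  apply: hD; first exact: bdd_meas01_cts (cRm t t0).
  by move=> x Ix; exact: Rm_bound.
have e1h : 0 <= e1 * h by rewrite mulr_ge0// ltW.
have b2 : `|\int[leb]_(s in `[0, t]) X1 s - \int[leb]_(s in `[0, t]) X2 s
    - h * \int[leb]_(s in `[0, t]) X3 s| <= C * K * T * (e1 * h).
  have mt : measurable (`[0, t]%classic : set R) by exact: measurable_itv.
  have ih3 : leb.-integrable `[0, t] (EFin \o (fun s => h * X3 s)).
    exact: (@integrableZl _ _ R leb _ mt h _ i3).
  have i12 : leb.-integrable `[0, t] (EFin \o (fun s => X1 s - X2 s)).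
    exact: (@integrableB _ _ R leb _ mt _ _ i10 i2).
  have i123 : leb.-integrable `[0, t] (EFin \o (fun s => X1 s - X2 s - h * X3 s)).
    exact: (@integrableB _ _ R leb _ mt _ _ i12 ih3).
  rewrite -RintegralZl// -RintegralB// -RintegralB//.
  apply: (@le_trans _ _ (C * (K * (e1 * h)) * (t - 0))); last first.
    rewrite subr0 (_ : C * K * T * _ = C * K * (e1 * h) * T); last by ring.
    rewrite (mulrA C K); apply: ler_wpM2l => //; exact: mulr_ge0.
  have [/measurable_EFinP mi _] := integrableP _ _ _ i123.
  apply: Rintegral_itv_bound => // s; rewrite in_itv/= => /andP[s0 st].
  have ts : 0 <= t - s by rewrite subr_ge0.
  have sT : s \in `[0, T] by rewrite in_itv/= s0 (le_trans st).
  have ds := daniell_pairing (mu s).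
  have E : t + h - s = t - s + h by ring.
  have bA : bdd_meas01 (fun x => f x * A t (Psi (t - s) x)).
    by apply: bdd_meas01M => //; exact: (bN _ (A t)).
  have bp : bdd_meas01 (fun x => f x * p t (Psi (t - s) x)).
    by apply: bdd_meas01M => //; exact: (bN _ (p t)).
  have bph : bdd_meas01 (fun x => f x * p (t + h) (Psi (t - s + h) x)).
    by apply: bdd_meas01M => //; apply: (bN _ (p (t + h))) => //; exact: addr_ge0.
  rewrite /X1 /X2 /X3 E -(daniellZ ds h bA) -(daniell_sub ds bph bp).
  rewrite -(daniell_sub ds (bdd_meas01B bph bp) (bdd_meas01Z h bA)).
  rewrite (@daniell_eq _ _ ds _ (fun x => f x * Rm (t - s) x)); last first.
    by move=> x _; rewrite /Rm; ring.
  apply: (pairing_density_bound muTV f_cts f_K f_f sT (cRm _ ts)) => x Ix.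
  exact: Rm_bound.
have b3 : `|\int[leb]_(s in `[t, t + h]) X1 s - \int[leb]_(s in `[t, t + h]) g s|
    <= C * K * (e1 * h).
  have mt : measurable (`[t, t + h]%classic : set R) by exact: measurable_itv.
  have iXg : leb.-integrable `[t, t + h] (EFin \o (fun s => X1 s - g s)).
    exact: (@integrableB _ _ R leb _ mt _ _ i1h igh).
  rewrite -RintegralB// (_ : C * K * (e1 * h) = C * (K * e1) * (t + h - t)); last by ring.
  have [/measurable_EFinP mi _] := integrableP _ _ _ iXg.
  apply: Rintegral_itv_bound => // s; rewrite in_itv/= => /andP[ts sth].
  have s0 : 0 <= s by exact: le_trans ts.
  have sT : s \in `[0, T] by rewrite in_itv/= s0 (le_trans sth).
  have q0 : 0 <= t + h - s by rewrite subr_ge0.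
  have ds := daniell_pairing (mu s); have cps := cp.1 s sT.
  have c1 : continuous (fun x => p (t + h) (Psi (t + h - s) x)) by exact: (cN _ (p (t + h))).
  have cc : continuous (fun x => p (t + h) (Psi (t + h - s) x) - p s x).
    by move=> x; apply: cvgB; [exact: c1|exact: cps].
  rewrite /X1 /g -(daniell_sub ds); try (by apply: bdd_meas01M => //; exact: bdd_meas01_cts).
  rewrite (@daniell_eq _ _ ds _
    (fun x => f x * (p (t + h) (Psi (t + h - s) x) - p s x))); last first.
    by move=> x _; ring.
  apply: (pairing_density_bound muTV f_cts f_K f_f sT cc) => x Ix.
  rewrite (pI _ _ (PsiI _ _)) (pI _ _ Ix); apply: hd2 => //; first exact: PsiI.
    have := Psi_lip 0 (t + h - s) x (lexx _) q0 Ix; rewrite add0r Psi0// => H1.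
    apply: (le_lt_trans H1); apply: le_lt_trans Lh; apply: ler_wpM2l; first exact: ltW.
    by lra.
  by rewrite ger0_norm//; lra.
have b4 : `|\int[leb]_(s in `[t, t + h]) a s - h * a t| <= e1 * h.
  have mt : measurable (`[t, t + h]%classic : set R) by exact: measurable_itv.
  have ic : leb.-integrable `[t, t + h] (EFin \o (fun=> a t)).
    by apply: (integrable_itv_bounded (c := `|a t|)).
  have iac : leb.-integrable `[t, t + h] (EFin \o (fun s => a s - a t)).
    exact: (@integrableB _ _ R leb _ mt _ _ iah ic).
  have -> : h * a t = \int[leb]_(s in `[t, t + h]) (a t).
    by rewrite Rintegral_itv_cst//; ring.
  rewrite -RintegralB// (_ : e1 * h = e1 * (t + h - t)); last by ring.
  have [/measurable_EFinP mi _] := integrableP _ _ _ iac.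
  apply: Rintegral_itv_bound => // s; rewrite in_itv/= => /andP[ts sth].
  apply: hd3 => //; first by rewrite in_itv/= (le_trans t0 ts) (le_trans sth).
  by rewrite ger0_norm; lra.
(* subtracting, the terms with index 3 recombine into the pairing of mu t with A t *)
have F1 : F (t + h) = N (t + h) (p (t + h)) + \int[leb]_(s in `[0, t + h]) X1 s by exact: mild.
have F2 : F t = N t (p t) + \int[leb]_(s in `[0, t]) X2 s by exact: mild.
have F3 : a t = N t (A t) + \int[leb]_(s in `[0, t]) X3 s by exact: mild.
rewrite (Rintegral_itv_chasles t0 tth i1) in F1.
rewrite /H (Rintegral_itv_chasles t0 tth iaT) (Rintegral_itv_chasles t0 tth igT).
rewrite F1 F2.
set I1 := \int[leb]_(s in `[0, t]) X1 s in b2 *.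
set I2 := \int[leb]_(s in `[0, t]) X2 s in b2 *.
set I3 := \int[leb]_(s in `[0, t]) X3 s in b2 F3 *.
set J1 := \int[leb]_(s in `[t, t + h]) X1 s in b3 *.
set J2 := \int[leb]_(s in `[t, t + h]) g s in b3 *.
set J3 := \int[leb]_(s in `[t, t + h]) a s in b4 *.
set Ia := \int[leb]_(s in `[0, t]) a s.
set Ig := \int[leb]_(s in `[0, t]) g s.
rewrite (_ : _ - _ = (N (t + h) (p (t + h)) - N t (p t) - h * N t (A t)) +
  (I1 - I2 - h * I3) + (J1 - J2) - (J3 - h * a t)); last by rewrite F3; ring.
rewrite (_ : e * h = D * (e1 * h) + C * K * T * (e1 * h) + C * K * (e1 * h) + e1 * h); last first.
  by rewrite (_ : e = Q * e1); [rewrite /Q; ring|rewrite /e1 mulrC divfK// gt_eqF].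
apply: (le_trans (ler_normB _ _)); apply: lerD => //.
apply: (le_trans (ler_normD _ _)); apply: lerD => //.
apply: (le_trans (ler_normD _ _)); exact: lerD.
Qed.
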